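(* Let $\lambda$ be a partition with at most $n$ parts and $\lambda_1>0$, and let $\lambda'$ denote its conjugate partition and $\ell(\lambda)$ its number of nonzero parts. For every subset $S\subseteq\{1,\dots,n\}$ with $\#S=\ell(\lambda)$, $$\sum_{\substack{\mu\in S_n(\lambda)\\ \mathrm{Supp}(\mu)=S}}f^*_\mu(x_1,\dots,x_n;1,t)=\prod_{i\in S}\left(x_i-\frac{t^{\#(S^c\cap\{1,\dots,i-1\})}}{t^{n-1}}\right)\prod_{2\le i\le\lambda_1}e^*_{\lambda'_i}(x_1,\dots,x_n;t).$$ Consequently, for every partition $\lambda$ with at most $n$ parts, $$P^*_\lambda(x_1,\dots,x_n;1,t)=\prod_{1\le i\le\lambda_1}P^*_{(1^{\lambda'_i},0^{n-\lambda'_i})}(x_1,\dots,x_n;1,t)=\prod_{1\le i\le\lambda_1}e^*_{\lambda'_i}(x_1,\dots,x_n;t).$$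
   Context: Polynomials are in $x_1,\dots,x_n$ over $\mathbb{Q}(q,t)$; $f(x;1,t)$ denotes specialization at $q=1$. For $\mu\in\mathbb{N}^n$ let $k_i(\mu)=\#\{j<i:\mu_j>\mu_i\}+\#\{j>i:\mu_j\ge\mu_i\}$ and $\widetilde\mu=(q^{\mu_1}t^{-k_1(\mu)},\dots,q^{\mu_n}t^{-k_n(\mu)})$. For $\mu\in\mathbb{N}^n$, $|\mu|=d$, $E^*_\mu$ is the unique polynomial of degree at most $d$ with coefficient of $x^\mu$ equal to $1$ and $E^*_\mu(\widetilde\nu)=0$ for all $\nu\in\mathbb{N}^n$, $|\nu|\le d$, $\nu\ne\mu$. $S_n$ acts on compositions by $\sigma\cdot\mu=(\mu_{\sigma^{-1}(1)},\dots,\mu_{\sigma^{-1}(n)})$ and on polynomials by permuting variables; $s_i=(i,i+1)$; $T_i=t-\frac{tx_i-x_{i+1}}{x_i-x_{i+1}}(1-s_i)$; $T_\sigma=T_{i_1}\cdots T_{i_\ell}$ for a reduced word. $S_n(\lambda)$ is the set of rearrangements of $\lambda$; for $\mu\in S_n(\lambda)$, $\sigma_\mu$ is the shortest permutation with $\sigma_\mu(\lambda)=\mu$ and $f^*_\mu=T_{\sigma_\mu}E^*_\lambda$. $P^*_\lambda$ is the unique symmetric polynomial of degree at most $|\lambda|$ with coefficient $1$ on the monomial symmetric polynomial $m_\lambda$ and vanishing at $\widetilde\nu$ for every partition $\nu\ne\lambda$ with $|\nu|\le|\lambda|$. $\mathrm{Supp}(\mu)=\{i:\mu_i>0\}$,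 $S^c$ is the complement of $S$ in $\{1,\dots,n\}$, and for $k\ge0$, $$e^*_k(x_1,\dots,x_n;t)=\sum_{S\subseteq\{1,\dots,n\},\ \#S=k}\ \prod_{i\in S}\left(x_i-\frac{t^{\#(S^c\cap\{1,\dots,i-1\})}}{t^{n-1}}\right).$$ *)

(* Defs.v *)
From HB Require Import structures.
From mathcomp Require Import all_boot all_order all_algebra all_fingroup.
From mathcomp Require Import fraction.
From mathcomp Require Export mpoly.
From Stdlib Require Import ClassicalEpsilon.

Set Implicit Arguments.
Unset Strict Implicit.
Unset Printing Implicit Defensive.

Import Order.TTheory GRing.Theory.
Local Open Scope ring_scope.

(* Q[t] = {poly rat} (variable t);  Q[t][q] = {poly {poly rat}}       *)
(* (outer variable q).  Q(q,t) = Frac(Q[t][q]),  Q(t) = Frac(Q[t]).    *)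
Definition Rqt : idomainType := {poly {poly rat}}.
Definition Kqt : fieldType := {fraction {poly {poly rat}}}.
Definition Kt : fieldType := {fraction {poly rat}}.

Definition frac_qt (a : {poly {poly rat}}) : Kqt := FracField.tofrac a.
Definition frac_t (a : {poly rat}) : Kt := FracField.tofrac a.

Definition qK : Kqt := frac_qt 'X.
Definition tK : Kqt := frac_qt ('X : {poly rat})%:P.
Definition tQ : Kt := frac_t 'X.

(* (The value g is unique when it exists.)                                *)
Definition spec1 (f : Kqt) (g : Kt) : Prop :=
  exists a b : {poly {poly rat}},
    [/\ b.[1] != 0, f = frac_qt a / frac_qt b & g = frac_t a.[1] / frac_t b.[1]].

Definition mspec1 n (f : {mpoly Kqt[n]}) (g : {mpoly Kt[n]}) : Prop :=
  forall m : 'X_{1..n}, spec1 f@_m g@_m.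

(* Compositions mu in N^n are monomials 'X_{1..n}; indices are 0-based. *)

Definition kidx n (mu : 'X_{1..n}) (i : 'I_n) : nat :=
  (#|[set j : 'I_n | (j < i)%N && (mu i < mu j)%N]|
   + #|[set j : 'I_n | (i < j)%N && (mu i <= mu j)%N]|)%N.

Definition tilde n (mu : 'X_{1..n}) : 'I_n -> Kqt :=
  fun i => qK ^+ (mu i) / tK ^+ (kidx mu i).

(* Interpolation nonsymmetric Macdonald polynomial E*_mu : the unique      *)
(* polynomial with the stated properties (chosen by epsilon).              *)
Definition IsEstar n (mu : 'X_{1..n}) (p : {mpoly Kqt[n]}) : Prop :=
  [/\ (msize p <= (mdeg mu).+1)%N, p@_mu = 1 &
      forall nu : 'X_{1..n}, (mdeg nu <= mdeg mu)%N -> nu != mu ->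
        p.@[tilde nu] = 0].

Definition Estar n (mu : 'X_{1..n}) : {mpoly Kqt[n]} :=
  epsilon (inhabits 0) (IsEstar mu).

Definition cact n (s : 'S_n) (mu : 'X_{1..n}) : 'X_{1..n} :=
  [multinom mu ((s^-1)%g j) | j < n].

Definition lo_ix n (i : 'I_n.-1) : 'I_n := widen_ord (leq_pred n) i.
Definition hi_ix n (i : 'I_n.-1) : 'I_n := insubd (lo_ix i) i.+1.
(* val (lo_ix i) = i and val (hi_ix i) = i+1 (since i + 1 < n) *)
Definition sadj n (i : 'I_n.-1) : 'S_n := tperm (lo_ix i) (hi_ix i).

(* the permutation s_{i1} o s_{i2} o ... o s_{il} (function composition) *)
Definition perm_of_word n (w : seq 'I_n.-1) : 'S_n :=
  foldr (fun i acc => (acc * sadj i)%g) 1%g w.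

(* Coxeter length = number of inversions *)
Definition plength n (s : 'S_n) : nat :=
  #|[set p : 'I_n * 'I_n | (p.1 < p.2)%N && (s p.2 < s p.1)%N]|.

Definition red_word n (s : 'S_n) : seq 'I_n.-1 :=
  if [pick w : (plength s).-tuple 'I_n.-1 | perm_of_word w == s] is Some w
  then val w else [::].

Definition spoly n (i : 'I_n.-1) (f : {mpoly Kqt[n]}) : {mpoly Kqt[n]} :=
  msym (sadj i) f.

Definition ddiff n (i : 'I_n.-1) (f : {mpoly Kqt[n]}) : {mpoly Kqt[n]} :=
  epsilon (inhabits 0)
    (fun g => ('X_(lo_ix i) - 'X_(hi_ix i)) * g = f - spoly i f).

Definition Hecke n (i : 'I_n.-1) (f : {mpoly Kqt[n]}) : {mpoly Kqt[n]} :=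
  tK *: f - (tK *: 'X_(lo_ix i) - 'X_(hi_ix i)) * ddiff i f.

Definition Tperm n (s : 'S_n) (f : {mpoly Kqt[n]}) : {mpoly Kqt[n]} :=
  foldr (fun i g => Hecke i g) f (red_word s).

Definition sigma_of n (lam mu : 'X_{1..n}) : 'S_n :=
  if [pick s : 'S_n | (cact s lam == mu) &&
        [forall s' : 'S_n, (cact s' lam == mu) ==> (plength s <= plength s')%N]]
  is Some s then s else 1%g.

Definition fstar n (lam mu : 'X_{1..n}) : {mpoly Kqt[n]} :=
  Tperm (sigma_of lam mu) (Estar lam).

Definition is_partition n (lam : 'X_{1..n}) : bool :=
  [forall i : 'I_n, forall j : 'I_n, (i <= j)%N ==> (lam j <= lam i)%N].

(* lam_1 (0 if n = 0) *)
Definition part1 n (lam : 'X_{1..n}) : nat := nth 0%N (val (val lam)) 0.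

Definition conjp n (lam : 'X_{1..n}) (i : nat) : nat :=
  #|[set j : 'I_n | (i <= lam j)%N]|.

Definition plen n (lam : 'X_{1..n}) : nat := #|[set j : 'I_n | (0 < lam j)%N]|.

Definition supp n (mu : 'X_{1..n}) : {set 'I_n} := [set i | (0 < mu i)%N].

Definition ones n (k : nat) : 'X_{1..n} := [multinom ((i < k)%N : nat) | i < n].

Definition IsPstar n (lam : 'X_{1..n}) (p : {mpoly Kqt[n]}) : Prop :=
  [/\ p \is symmetric, (msize p <= (mdeg lam).+1)%N, p@_lam = 1 &
      forall nu : 'X_{1..n}, is_partition nu -> (mdeg nu <= mdeg lam)%N ->
        nu != lam -> p.@[tilde nu] = 0].

Definition Pstar n (lam : 'X_{1..n}) : {mpoly Kqt[n]} :=
  epsilon (inhabits 0) (IsPstar lam).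

Definition Sfactor n (S : {set 'I_n}) : {mpoly Kt[n]} :=
  \prod_(i in S)
     ('X_i - (tQ ^+ #|[set j in ~: S | (j < i)%N]| / tQ ^+ n.-1)%:MP).

Definition estar n (k : nat) : {mpoly Kt[n]} :=
  \sum_(S : {set 'I_n} | #|S| == k) Sfactor S.

(* Main.v *)
Require Import Defs.
From HB Require Import structures.
From mathcomp Require Import all_boot all_order all_algebra all_fingroup.
From mathcomp Require Import fraction mpoly.
From mathcomp Require Import zify ring.
From Stdlib Require Import ClassicalEpsilon.

Set Implicit Arguments.
Unset Strict Implicit.
Unset Printing Implicit Defensive.

Import Order.TTheory GRing.Theory.
Local Open Scope ring_scope.

(** Proof idea.  For every composition [mu], the interpolation polynomial [E*_mu] is built from
    [1] by Hecke intertwiners [T_i - a] and by raising operators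
    [p |-> prod_(i < k) (x_i - t^(1-n)) * p (x_k, .., x_(n-1), x_0 / q, .., x_(k-1) / q)]; both
    preserve vanishing, regularity at [q = 1], a dominance bound on the monomials, and
    unitriangularity of the coefficients of [x^nu], [nu] a rearrangement of [mu], with respect
    to the number of inversions of [nu].  Hence an element of the span [U_lam] of the [E*_nu],
    [nu] in [S_n(lam)], is determined by its coefficients on [S_n(lam)]; as [T_i] acts on these
    in the obvious way, [f*_mu] is the element of [U_lam] with coefficients [delta_mu], whatever
    reduced word is used.

    At [q = 1] the Hecke and raising operators are linear over symmetric polynomials, and the
    intertwining relation at an ascent of an increasing [mu] degenerates to [T_i E = t E], so
    that [E*_mu] is symmetric.  If [A] is the value at [q = 1] of [E*_mu] for [mu] the increasing
    rearrangement of [lam] with its first column removed, then [Sfactor {1..k} * A], with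
    [k = lam'_1], is a raised polynomial and lies in [U_lam]; applying the [T_i], so does
    [Sfactor S * A] for every [S] of size [k], and its coefficient at [x^nu] is 1 if
    [Supp nu = S] and 0 otherwise.  This gives the first formula, and summing over [S] computes
    [A] recursively as a product of [e*]'s.  For generic [q] the sum of all [f*_mu] has equal
    coefficients on [S_n(lam)], hence is fixed by Hecke operators and equals [P*_lam]. *)

(** * Demazure-Lusztig operators *)

Section HeckeOperator.

Variables (K : fieldType) (n : nat).
Implicit Types (t : K) (a b : 'I_n) (m : 'X_{1..n}) (f g : {mpoly K[n]}).

Definition swm a b m : 'X_{1..n} := [multinom m (tperm a b j) | j < n].

Definition setm a b m (u v : nat) : 'X_{1..n} :=
  [multinom if j == a then u else if j == b then v else m j | j < n].

Definition restm a b m : 'X_{1..n} :=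
  [multinom if (j == a) || (j == b) then 0%N else m j | j < n].

Lemma swmK a b : involutive (swm a b).
Proof. by move=> m; apply/mnmP=> j; rewrite !mnmE tpermK. Qed.

Lemma swmE a b m j : swm a b m j = m (tperm a b j).
Proof. by rewrite mnmE. Qed.

Lemma swmL a b m : swm a b m a = m b.
Proof. by rewrite mnmE tpermL. Qed.

Lemma swmR a b m : swm a b m b = m a.
Proof. by rewrite mnmE tpermR. Qed.

Lemma swmD a b m j : a != j -> b != j -> swm a b m j = m j.
Proof. by move=> h1 h2; rewrite mnmE tpermD. Qed.

Lemma swm_id a b m : m a = m b -> swm a b m = m.
Proof. by move=> e; apply/mnmP=> j; rewrite mnmE; case: tpermP => // ->. Qed.

Lemma swm_neq a b m : m a != m b -> swm a b m != m.
Proof. by apply: contraNneq => e; rewrite -[in m a]e swmL. Qed.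

Lemma mdeg_swm a b m : mdeg (swm a b m) = mdeg m.
Proof. exact: mdeg_mperm. Qed.

Lemma setm_id a b m : setm a b m (m a) (m b) = m.
Proof. by apply/mnmP=> j; rewrite mnmE; case: eqP => [->|_] //; case: eqP => [->|]. Qed.

Lemma setm_sw a b m : setm a b m (m b) (m a) = swm a b m.
Proof.
apply/mnmP=> j; rewrite !mnmE; case: tpermP => [->|->|/eqP/negPf-> /eqP/negPf->] //.
  by rewrite eqxx.
by rewrite eqxx; case: eqP => // ->.
Qed.

Lemma mpolyX_setm a b m u v : a != b ->
  'X_[setm a b m u v] = 'X_[restm a b m] * 'X_a ^+ u * 'X_b ^+ v :> {mpoly K[n]}.
Proof.
move=> ab; rewrite !mpolyXn -!mpolyXD; congr 'X_[_]; apply/mnmP=> j.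
rewrite !mnmE !mulmnE !mnm1E; case: (j =P a) => [->|/eqP ja].
  by rewrite !eqxx (eq_sym b) (negPf ab) mul0n addn0 mul1n add0n.
case: (j =P b) => [->|/eqP jb]; first by rewrite !eqxx (negPf ab) mul0n mul1n.
by rewrite (eq_sym a) (eq_sym b) (negPf ja) (negPf jb) !mul0n !addn0.
Qed.

Lemma msym_tpermX a b m : msym (tperm a b) ('X_[m] : {mpoly K[n]}) = 'X_[swm a b m].
Proof. by rewrite msymX tpermV. Qed.

Lemma msym_tpermK a b f : msym (tperm a b) (msym (tperm a b) f) = f.
Proof. by rewrite -msymMm tperm2 msym1m. Qed.

Lemma meval_msym (s : 'S_n) f (v : 'I_n -> K) : (msym s f).@[v] = f.@[v \o s].
Proof.
rewrite [RHS]mevalE /msym /mmap raddf_sum /=; apply: eq_bigr => m _.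
rewrite mevalM mevalC /mmap1 rmorph_prod /=; congr (_ * _); apply: eq_bigr => j _.
by rewrite rmorphXn /= mevalXU.
Qed.

Lemma msym_mpolyE (s : 'S_n) f :
  msym s f = \sum_(m <- msupp f) f@_m *: msym s 'X_[m].
Proof.
by rewrite /msym /mmap; apply: eq_bigr => m _; rewrite -mul_mpolyC -[in RHS]/(mmap _ _ _) mmapX.
Qed.

Lemma mpolyXB_neq0 a b : a != b -> ('X_a - 'X_b : {mpoly K[n]}) != 0.
Proof.
move=> ab; rewrite subr_eq0; apply: contraNneq ab => /(congr1 (mcoeff U_(a))).
rewrite !mcoeffXU eqxx eq_sym; case: eqP => // _ /eqP.
by rewrite oner_eq0.
Qed.

(** Ensures that the choice operator in [ddiff] picks a genuine quotient. By linearity only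
    monomials matter, and there the factorisation of [X_a^c - X_b^c] gives the quotient. *)
Lemma dvd_difference a b f : a != b ->
  exists g, ('X_a - 'X_b) * g = f - msym (tperm a b) f.
Proof.
move=> ab.
have mono m : exists g, ('X_a - 'X_b) * g = 'X_[m] - msym (tperm a b) 'X_[m].
  wlog le_ba : m / (m b <= m a)%N => [th|].
    case: (leqP (m b) (m a)) => [/th//|/ltnW lt_ab].
    have [|g e] := th (swm a b m); first by rewrite swmL swmR.
    by exists (- g); rewrite mulrN e !msym_tpermX swmK opprB.
  rewrite msym_tpermX -{1}(setm_id a b m) -setm_sw !(mpolyX_setm m _ _ ab).
  rewrite -(subnK le_ba); set c := (m a - m b)%N; set v := m b.
  have := subrXX ('X_a : {mpoly K[n]}) 'X_b c; set S := (X in _ * X) => e.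
  exists ('X_[restm a b m] * 'X_a ^+ v * 'X_b ^+ v * S).
  by rewrite mulrCA -e !exprD; ring.
rewrite [f]mpolyE; elim: (msupp f) => [|m s [g IH]].
  by exists 0; rewrite big_nil raddf0 subr0 mulr0.
have [g' e] := mono m; exists (f@_m *: g' + g).
rewrite big_cons mulrDr IH -scalerAr e msymD msymZ scalerBr.
by rewrite opprD addrACA.
Qed.

(** [hk_stay], [hk_swap] and [hk_mid] are the coefficients, in the image of [x^m], of [x^m], of its
    swap and of each monomial strictly between the two. *)
Definition hk_stay t a b m : K :=
  if m a == m b then t else if (m b < m a)%N then 0 else t - 1.
Definition hk_swap t a b m : K :=
  if m a == m b then 0 else if (m b < m a)%N then 1 else t.
Definition hk_mid t a b m : K := if (m b < m a)%N then 1 - t else t - 1.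

Lemma hk_stay_swap t a b m : hk_stay t a b m + hk_swap t a b (swm a b m) = t.
Proof.
rewrite /hk_stay /hk_swap swmL swmR.
by case: (ltngtP (m a) (m b)) => _; rewrite ?subrK ?add0r ?addr0.
Qed.

Definition midX a b m : {mpoly K[n]} :=
  let u := maxn (m a) (m b) in let v := minn (m a) (m b) in
  \sum_(j < (u - v).-1) 'X_[setm a b m (u.-1 - j) (v.+1 + j)].
Definition hkX t a b m : {mpoly K[n]} :=
  hk_stay t a b m *: 'X_[m] + hk_swap t a b m *: 'X_[swm a b m]
  + hk_mid t a b m *: midX a b m.

(* The operator [t - (t x_a - x_b) / (x_a - x_b) (1 - s_ab)], expanded on monomials. *)
Definition hk t a b f : {mpoly K[n]} := \sum_(m <- msupp f) f@_m *: hkX t a b m.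

Lemma midXE a b m : a != b -> let u := maxn (m a) (m b) in let v := minn (m a) (m b) in
  (v < u)%N ->
  ('X_a - 'X_b) * midX a b m
  = 'X_[restm a b m] * ('X_a ^+ u * 'X_b ^+ v.+1 - 'X_a ^+ v.+1 * 'X_b ^+ u).
Proof.
move=> ab u v lt_vu; rewrite /midX -/u -/v.
have -> : 'X_a ^+ u = 'X_a ^+ ((u - v).-1 + v.+1) :> {mpoly K[n]} by congr (_ ^+ _); lia.
have -> : 'X_b ^+ u = 'X_b ^+ ((u - v).-1 + v.+1) :> {mpoly K[n]} by congr (_ ^+ _); lia.
set c := (u - v).-1.
have := subrXX ('X_a : {mpoly K[n]}) 'X_b c; set S := (X in _ * X) => e.
have -> : \sum_(j < c) 'X_[setm a b m (u.-1 - j) (v.+1 + j)]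
   = 'X_[restm a b m] * 'X_a ^+ v.+1 * 'X_b ^+ v.+1 * S.
  rewrite mulr_sumr; apply: eq_bigr => j _; rewrite (mpolyX_setm m _ _ ab).
  have -> : (u.-1 - j = v.+1 + (c.-1 - j))%N by move: (ltn_ord j); rewrite {2}/c; lia.
  rewrite !exprD; move: 'X_[_] ('X_a ^+ v.+1) ('X_b ^+ v.+1) ('X_a ^+ (c.-1 - j)) ('X_b ^+ j).
  by move=> x1 x2 x3 x4 x5; ring.
rewrite mulrCA -e [in RHS]exprD [_ ^+ (c + _)]exprD.
move: 'X_[_] ('X_a ^+ v.+1) ('X_b ^+ v.+1) ('X_a ^+ c) ('X_b ^+ c).
by move=> x1 x2 x3 x4 x5; ring.
Qed.

Lemma hkX_spec t a b m : a != b ->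
  ('X_a - 'X_b) * hkX t a b m =
  (1 - t)%:MP * 'X_b * 'X_[m] + (t%:MP * 'X_a - 'X_b) * 'X_[swm a b m].
Proof.
move=> ab; rewrite /hkX !mulrDr -!mul_mpolyC.
rewrite [_ * (_ * midX _ _ _)]mulrCA.
have eX : 'X_[m] = 'X_[restm a b m] * 'X_a ^+ m a * 'X_b ^+ m b :> {mpoly K[n]}.
  by rewrite -mpolyX_setm // setm_id.
have eS : 'X_[swm a b m] = 'X_[restm a b m] * 'X_a ^+ m b * 'X_b ^+ m a :> {mpoly K[n]}.
  by rewrite -mpolyX_setm // setm_sw.
have := @midXE a b m ab; rewrite /= /hk_stay /hk_swap /hk_mid.
case: (ltngtP (m a) (m b)) => h.
- move=> /(_ h)->; rewrite eX eS.
  by rewrite !mpolyCD !mpolyCN mpolyC1 !exprS; ring.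
- move=> /(_ h)->; rewrite eX eS.
  by rewrite !mpolyCD !mpolyCN mpolyC1 mpolyC0 !exprS; ring.
- move=> _; rewrite /midX h maxnn minnn subnn /= big_ord0 swm_id //.
  by rewrite mpolyC0 !mpolyCD !mpolyCN mpolyC1; ring.
Qed.

Lemma hkE t a b f : a != b ->
  ('X_a - 'X_b) * hk t a b f =
  (1 - t)%:MP * 'X_b * f + (t%:MP * 'X_a - 'X_b) * msym (tperm a b) f.
Proof.
move=> ab; rewrite /hk mulr_sumr [X in _ = _ * X + _]mpolyE mulr_sumr.
rewrite msym_mpolyE mulr_sumr -big_split /=.
apply: eq_bigr => m _; rewrite -scalerAr hkX_spec // msym_tpermX.
by rewrite scalerDr !scalerAr.
Qed.

(** Multiplication by [X_a - X_b] is injective, so identities for the operator can be checked after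
    clearing the denominator, as is done below for linearity, the quadratic relation and symmetric
    factors. *)
Lemma hkP t a b f g : a != b ->
  ('X_a - 'X_b) * g =
    (1 - t)%:MP * 'X_b * f + (t%:MP * 'X_a - 'X_b) * msym (tperm a b) f ->
  hk t a b f = g.
Proof. by move=> ab; rewrite -hkE // => /(mulfI (mpolyXB_neq0 ab)). Qed.

Lemma hk_linear t a b : a != b -> linear (hk t a b).
Proof.
move=> ab c f g; apply: hkP => //; rewrite mulrDr -scalerAr !hkE //.
by rewrite msymD msymZ -!mul_mpolyC; ring.
Qed.

Lemma hkD t a b f g : a != b -> hk t a b (f + g) = hk t a b f + hk t a b g.
Proof. by move=> ab; have := hk_linear t ab 1 f g; rewrite !scale1r. Qed.

Lemma hk0 t a b : hk t a b 0 = 0.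
Proof. by rewrite /hk msupp0 big_nil. Qed.

Lemma hkZ t a b c f : a != b -> hk t a b (c *: f) = c *: hk t a b f.
Proof. by move=> ab; have := hk_linear t ab c f 0; rewrite hk0 !addr0. Qed.

Lemma hk_sum t a b (I : Type) (r : seq I) (P : pred I) (F : I -> {mpoly K[n]}) :
  a != b -> hk t a b (\sum_(i <- r | P i) F i) = \sum_(i <- r | P i) hk t a b (F i).
Proof.
move=> ab; elim: r => [|i r IH]; first by rewrite !big_nil hk0.
by rewrite !big_cons; case: (P i); rewrite // hkD // IH.
Qed.

Lemma hk_quadratic t a b f : a != b ->
  hk t a b (hk t a b f) = (t - 1) *: hk t a b f + t *: f.
Proof.
move=> ab; apply: hkP => //; apply: (mulfI (mpolyXB_neq0 ab)).
(* The goal, multiplied once more by [X_a - X_b], is a combination of the defining identity [e1] and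
   its image [e2] under the swap. *)
have e1 := hkE t f ab; have := congr1 (msym (tperm a b)) e1.
rewrite !(msymM, msymD, msymN) msym_tpermK => e2.
have xa : msym (tperm a b) 'X_a = 'X_b :> {mpoly K[n]}.
  by rewrite /msym mmapX mmap1U tpermL.
have xb : msym (tperm a b) 'X_b = 'X_a :> {mpoly K[n]}.
  by rewrite /msym mmapX mmap1U tpermR.
have cC (c : K) : msym (tperm a b) c%:MP = c%:MP by rewrite /msym mmapC.
move: e2; rewrite xa xb !cC => e2.
rewrite -!mul_mpolyC [LHS]mulrA mulrDr.
set h := hk t a b f in e1 e2 *; set h' := msym _ h in e2 *.
set f' := msym _ f in e1 e2 *.
transitivity (('X_a - 'X_b) * (t - 1)%:MP * (('X_a - 'X_b) * h) + ('X_a - 'X_b) ^+ 2 * (t%:MP * f)).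
  by ring.
transitivity ((1 - t)%:MP * 'X_b * (('X_a - 'X_b) * h) 
  - (t%:MP * 'X_a - 'X_b) * (('X_b - 'X_a) * h')); last by ring.
rewrite e1 e2 !mpolyCD !mpolyCN mpolyC1; ring.
Qed.

Lemma hk_mulsym t a b f g : a != b -> msym (tperm a b) g = g ->
  hk t a b (f * g) = hk t a b f * g.
Proof.
move=> ab e; apply: hkP => //; rewrite mulrA hkE // msymM e; ring.
Qed.

(** After clearing the denominator the hypothesis reads [(t X_a - X_b) (f - s f) = 0], and the first
    factor is nonzero. *)
Lemma hk_fix t a b f : a != b -> t != 0 -> hk t a b f = t *: f -> msym (tperm a b) f = f.
Proof.
move=> ab t0 e; have := hkE t f ab; rewrite e => /eqP.
rewrite -subr_eq0 -mul_mpolyC !mpolyCD !mpolyCN mpolyC1.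
have -> : ('X_a - 'X_b) * (t%:MP * f)
  - ((1 - t%:MP) * 'X_b * f + (t%:MP * 'X_a - 'X_b) * msym (tperm a b) f)
  = (t%:MP * 'X_a - 'X_b) * (f - msym (tperm a b) f) by ring.
rewrite mulf_eq0 [X in _ || X]subr_eq0 => /orP[|/eqP//] /eqP.
move/(congr1 (mcoeff U_(a))); rewrite mcoeffB mcoeffCM !mcoeffXU eqxx eq_sym (negPf ab).
by rewrite mcoeff0 subr0 mulr1 => /eqP; rewrite (negPf t0).
Qed.

Lemma meval_hk t a b f (v : 'I_n -> K) : a != b -> 
  (v a - v b) * (hk t a b f).@[v] =
  (1 - t) * v b * f.@[v] + (t * v a - v b) * f.@[v \o tperm a b].
Proof.
move=> ab; have := congr1 (meval v) (hkE t f ab).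
by rewrite !(mevalM, mevalD, mevalN, mevalC, mevalXU) meval_msym.
Qed.

(** The exponents at [a] and [b] move strictly towards each other, with their sum kept; these are
    the monomials of [midX]. *)
Definition between a b m m' :=
  [/\ forall l, l != a -> l != b -> m' l = m l, (m' a + m' b = m a + m b)%N,
      (minn (m a) (m b) < m' a)%N & (m' a < maxn (m a) (m b))%N].

Lemma midX_supp a b m m' : a != b -> (midX a b m)@_m' != 0 -> between a b m m'.
Proof.
move=> ab; rewrite /midX raddf_sum /=.
case: (boolP [exists j : 'I_(maxn (m a) (m b) - minn (m a) (m b)).-1,
   m' == setm a b m ((maxn (m a) (m b)).-1 - j) ((minn (m a) (m b)).+1 + j)]).
  case/existsP=> j /eqP-> _; have := ltn_ord j; rewrite /between !mnmE !eqxx eq_sym (negPf ab).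
  move=> lt_j; split; try lia.
  by move=> l la lb; rewrite mnmE (negPf la) (negPf lb).
rewrite negb_exists => /forallP h; rewrite big1 ?eqxx // => j _.
by rewrite mcoeffX eq_sym (negPf (h j)).
Qed.

Lemma hkX_supp t a b m m' : a != b -> (hkX t a b m)@_m' != 0 ->
  [\/ m' = m, m' = swm a b m | between a b m m'].
Proof.
move=> ab; rewrite /hkX !mcoeffD !mcoeffZ !mcoeffX.
case: (m =P m') => [->|_]; first by constructor 1.
case: (swm a b m =P m') => [->|_]; first by constructor 2.
rewrite !mulr0 !add0r => h; constructor 3; apply: midX_supp => //.
by apply: contraNneq h => ->; rewrite mulr0.
Qed.

Lemma hk_supp t a b f m' : a != b -> (hk t a b f)@_m' != 0 ->
  exists2 m, f@_m != 0 & [\/ m' = m, m' = swm a b m | between a b m m'].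
Proof.
move=> ab; rewrite /hk raddf_sum /=.
case: (boolP (has (fun m => (hkX t a b m)@_m' != 0) (msupp f))).
  case/hasP=> m mf /(hkX_supp ab) h _; exists m => //.
  by rewrite -mcoeff_msupp.
move/hasPn=> h; rewrite big1_seq ?eqxx // => m /= mf.
by rewrite mcoeffZ; have := h m mf; rewrite negbK => /eqP->; rewrite mulr0.
Qed.

Lemma sum_msupp_eq f (G : 'X_{1..n} -> K) k :
  \sum_(m <- msupp f) f@_m * (G m * (m == k)%:R) = f@_k * G k.
Proof.
case: (boolP (k \in msupp f)) => kf.
  rewrite (bigD1_seq k) ?msupp_uniq //= eqxx mulr1 big1 ?addr0 // => m /negPf->.
  by rewrite !mulr0.
rewrite (memN_msupp_eq0 kf) mul0r big1_seq // => m /= mf.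
by case: (m =P k) kf mf => [->/negPf->|_] //; rewrite !mulr0.
Qed.

(** The support condition rules out the intermediate terms, so only [k] and its swap contribute. *)
Lemma mcoeff_hk t a b f k : a != b ->
  (forall m, f@_m != 0 -> ~ between a b m k) ->
  (hk t a b f)@_k = hk_stay t a b k * f@_k
                    + hk_swap t a b (swm a b k) * f@_(swm a b k).
Proof.
move=> ab h; rewrite /hk raddf_sum /= ![_ * f@_ _]mulrC -!sum_msupp_eq -big_split /=.
apply: eq_big_seq => m mf; rewrite mcoeffZ /hkX !mcoeffD !mcoeffZ !mcoeffX -mulrDr.
congr (_ * _); have -> : (midX a b m)@_k = 0.
  apply/eqP; apply/negP => /negP /(midX_supp ab).
  by apply: h; rewrite -mcoeff_msupp.
rewrite mulr0 addr0; congr (_ + _ * _%:R).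
by rewrite (can2_eq (swmK a b) (swmK a b)).
Qed.

End HeckeOperator.

(** * Compositions, ranks and dominance *)

Ltac ordlia := repeat match goal with 
  [ H : is_true (_ != _) |- _ ] => rewrite -val_eqE /= in H end; lia.

Section Compositions.

Variable n : nat.
Implicit Types (mu nu lam m : 'X_{1..n}) (a b i j l : 'I_n).

Lemma hi_ixE (i : 'I_n.-1) : hi_ix i = (lo_ix i).+1 :> nat.
Proof. by rewrite /hi_ix val_insubd /=; have := ltn_ord i; case: ifP => //; lia. Qed.

Lemma adj_neq a b : b = a.+1 :> nat -> a != b.
Proof. by move=> e; apply/eqP => /(congr1 val) /=; lia. Qed.

Lemma lo_hi_neq (i : 'I_n.-1) : lo_ix i != hi_ix i.
Proof. exact: adj_neq (hi_ixE i). Qed.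

(** A strict total order on positions: larger parts win, and ties go to the later position.
    [kidx mu i] is the rank of [i], whence ranks are distinct. *)
Definition beats mu l i : bool := (mu i < mu l)%N || ((mu i == mu l) && (i < l)%N).

Lemma kidxE mu i : kidx mu i = #|[set l | beats mu l i]|.
Proof.
rewrite /kidx -cardsUI [X in (_ + X)%N](_ : _ = 0%N) ?addn0; last first.
  by apply: eq_card0 => l; rewrite !inE; lia.
apply: eq_card => l; rewrite !inE /beats; case: (eqVneq l i) => [->|]; first by lia.
by rewrite -val_eqE /=; lia.
Qed.

Lemma kidx_lt mu l i : beats mu l i -> (kidx mu l < kidx mu i)%N.
Proof.
move=> h; rewrite !kidxE; apply: proper_card; apply/properP; split.
  by apply/subsetP => x; rewrite !inE; move: h; rewrite /beats; lia.
by exists l; rewrite !inE // /beats; lia.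
Qed.

Lemma kidx_neq mu i l : i != l -> kidx mu i != kidx mu l.
Proof.
move=> h; have {}h : i != l :> nat by [].
have /orP[] : beats mu i l || beats mu l i by rewrite /beats; lia.
  by move/kidx_lt; lia.
by move/kidx_lt; lia.
Qed.

Lemma kidx_reindex (s : 'S_n) mu nu j :
  (forall l i, beats nu l i = beats mu (s l) (s i)) -> kidx nu j = kidx mu (s j).
Proof.
move=> h; rewrite !kidxE -(card_imset _ (@perm_inj _ s)); apply: eq_card => x.
rewrite inE; apply/imsetP/idP => [[y]|].
  by rewrite inE h => ? ->.
by move=> bx; exists (s^-1 x)%g; rewrite ?inE ?h permKV.
Qed.

Lemma kidx_swm a b mu j : b = a.+1 :> nat -> mu a != mu b ->
  kidx (swm a b mu) j = kidx mu (tperm a b j).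
Proof.
move=> e ne; apply: kidx_reindex => l i; rewrite /beats !swmE.
case: (tpermP a b l) => [->|->|/eqP la /eqP lb];
case: (tpermP a b i) => [->|->|/eqP ia /eqP ib]; try lia.
all: ordlia.
Qed.

(** Here [a] comes immediately after [b] in the ranking: it is beaten by [b] and by whatever beats
    [b]. *)
Lemma kidx_adj a b mu : b = a.+1 :> nat ->
  (forall l, l != b -> beats mu l a = beats mu l b) -> beats mu b a ->
  kidx mu a = (kidx mu b).+1.
Proof.
move=> e h hb; rewrite !kidxE -add1n.
have -> : [set l | beats mu l a] = b |: [set l | beats mu l b].
  apply/setP=> l; rewrite !inE; case: eqP => [->|/eqP lb] /=; first exact: hb.
  exact: h.
by rewrite cardsU1 inE /beats; lia.
Qed.

Lemma kidx_eq a b mu : b = a.+1 :> nat -> mu a = mu b -> kidx mu a = (kidx mu b).+1.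
Proof.
move=> e h; apply: kidx_adj => // [l lb|]; last by rewrite /beats; lia.
have {}lb : (l : nat) != b by [].
by rewrite /beats h; lia.
Qed.

(** Every other position beats the first zero part, so [tilde nu] equals [t^(1-n)] there, a root of
    the linear factors of [raise]. *)
Lemma kidx_zero nu i : nu i = 0%N -> (forall l, (l < i)%N -> (0 < nu l)%N) ->
  kidx nu i = n.-1.
Proof.
move=> z pos; rewrite kidxE; have -> : [set l | beats nu l i] = [set~ i].
  apply/setP=> l; rewrite !inE /beats z -val_eqE /=; have := pos l.
  by case: (ltngtP l i) => h; [move=> /(_ isT); lia|lia|move=> _; rewrite (ord_inj h) z].
by rewrite cardsC1 card_ord.
Qed.


(** Pairs violating the partition order; this is the length of the shortest permutation that takes
    the sorted composition to [mu]. *)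
Definition inv mu : nat :=
  #|[set p : 'I_n * 'I_n | (p.1 < p.2)%N && (mu p.1 < mu p.2)%N]|.

Lemma inv_swm a b mu : b = a.+1 :> nat -> (mu b < mu a)%N ->
  inv (swm a b mu) = (inv mu).+1.
Proof.
move=> e lt_ba; pose s := tperm a b.
pose f (p : 'I_n * 'I_n) := (s p.1, s p.2).
have fK : involutive f by case=> x y; rewrite /f /= !tpermK.
rewrite /inv; set A := [set p | _ && (mu p.1 < _)%N].
rewrite -(card_imset A (inv_inj fK)) (can_imset_pre _ fK).
(* As [a] and [b] are adjacent, the swap carries counted pairs to counted pairs, and [(a, b)] is the
   only new one. *)
have -> : [set p : 'I_n * 'I_n | (p.1 < p.2)%N && (swm a b mu p.1 < swm a b mu p.2)%N]
   = (a, b) |: f @^-1: A.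
  apply/setP=> -[x y]; rewrite !inE /f /= /s !swmE xpair_eqE.
  case: (tpermP a b x) => [->|->|/eqP xa /eqP xb];
  case: (tpermP a b y) => [->|->|/eqP ya /eqP yb]; rewrite -!val_eqE /=; ordlia.
by rewrite cardsU1 !inE /f /= /s tpermL tpermR e; lia.
Qed.

Definition rearr mu nu : bool := perm_eq (val (val mu)) (val (val nu)).

Lemma rearrP mu nu :
  reflect (exists s : 'S_n, mu = [multinom nu (s j) | j < n]) (rearr mu nu).
Proof.
apply: (iffP tuple_permP) => -[s e]; exists s.
  by apply: val_inj; apply: val_inj; rewrite e.
by rewrite e.
Qed.

Lemma rearr_refl mu : rearr mu mu. Proof. exact: perm_refl. Qed.

Lemma rearr_sym mu nu : rearr mu nu = rearr nu mu. Proof. exact: perm_sym. Qed.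

Lemma rearr_trans mu nu lam : rearr mu nu -> rearr nu lam -> rearr mu lam.
Proof. exact: perm_trans. Qed.

Lemma rearr_swm a b mu : rearr (swm a b mu) mu.
Proof. by apply/rearrP; exists (tperm a b). Qed.

Lemma mdeg_rearr mu nu : rearr mu nu -> mdeg mu = mdeg nu.
Proof. by case/rearrP=> s ->; rewrite mdeg_mperm. Qed.

Lemma conjp_rearr mu nu c : rearr mu nu -> conjp mu c = conjp nu c.
Proof.
case/rearrP=> s ->; rewrite /conjp -(card_imset _ (@perm_inj _ s)); apply: eq_card => x.
rewrite inE; apply/imsetP/idP => [[y]|h].
  by rewrite inE mnmE => ? ->.
by exists (s^-1 x)%g; rewrite ?inE ?mnmE permKV.
Qed.

Lemma partitionP lam :
  reflect (forall i j, (i <= j)%N -> (lam j <= lam i)%N) (is_partition lam).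
Proof.
apply: (iffP forallP) => h i.
  by move=> j ij; have /forallP/(_ j)/implyP := h i; apply.
by apply/forallP=> j; apply/implyP; apply: h.
Qed.

Lemma ascentP mu : ~~ is_partition mu ->
  exists i : 'I_n.-1, (mu (lo_ix i) < mu (hi_ix i))%N.
Proof.
move=> np; apply/existsP; apply: contraR np; rewrite negb_exists => /forallP h.
apply/partitionP => i j le_ij; have [d e] : exists d, (j = i + d :> nat)%N.
  by exists (j - i)%N; lia.
elim: d j e {le_ij} => [|d IH] j e.
  by rewrite (_ : j = i) //; apply: val_inj; rewrite /= e addn0.
have ltd : (i + d < n.-1)%N by have := ltn_ord j; lia.
have := h (Ordinal ltd); rewrite -leqNgt.
have -> : hi_ix (Ordinal ltd) = j by apply: ord_inj; rewrite hi_ixE /= e addnS.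
by move=> h1; apply: leq_trans h1 _; apply: IH.
Qed.

Lemma rearr_partition lam mu : is_partition lam -> is_partition mu -> rearr lam mu -> lam = mu.
Proof.
move=> /partitionP pl /partitionP pm h; apply: val_inj; apply: val_inj.
have srt nu : (forall i j, (i <= j)%N -> (nu j <= nu i)%N) -> sorted geq (val (val nu)).
  move=> p; apply/(sortedP 0%N) => i; rewrite size_tuple => lt_i.
  have lt_i' := ltnW lt_i.
  have := p (Ordinal lt_i') (Ordinal lt_i) (leqnSn _).
  by rewrite !(mnm_nth 0%N).
apply: (sorted_eq _ _ (srt _ pl) (srt _ pm) h); first by move=> x y z; lia.
by move=> x y; lia.
Qed.

(** Induction on [inv]: a composition that is not a partition has an adjacent ascent, and undoing it
    lowers [inv] by one. *)
Lemma sort_ind (P : 'X_{1..n} -> Prop) :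
  (forall lam, is_partition lam -> P lam) ->
  (forall mu (i : 'I_n.-1), (mu (hi_ix i) < mu (lo_ix i))%N -> P mu ->
     P (swm (lo_ix i) (hi_ix i) mu)) ->
  forall mu, P mu.
Proof.
move=> P0 PS mu; have [k] := ubnP (inv mu); elim: k mu => // k IH mu lt_mu.
case: (boolP (is_partition mu)) => [/P0//|/ascentP[i lt_i]].
rewrite -(swmK (lo_ix i) (hi_ix i) mu); set nu := swm _ _ mu.
have lt_nu : (nu (hi_ix i) < nu (lo_ix i))%N by rewrite swmL swmR.
apply: PS => //; apply: IH; have := inv_swm (hi_ixE i) lt_nu.
by rewrite /nu swmK => e; move: lt_mu; rewrite e ltnS.
Qed.

(** For [r <= n], the sum of the [r] largest parts, written through the conjugate partition so that
    invariance under rearrangement is immediate and nothing has to be sorted. *)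
Definition topsum mu (r : nat) : nat := (\sum_(c < mdeg mu) minn r (conjp mu c.+1))%N.

Lemma topsum_rearr mu nu r : rearr mu nu -> topsum mu r = topsum nu r.
Proof.
move=> h; rewrite /topsum (mdeg_rearr h); apply: eq_bigr => c _.
by rewrite (conjp_rearr _ h).
Qed.

Lemma leq_mdeg mu i : (mu i <= mdeg mu)%N.
Proof. by rewrite mdegE (bigD1 i) //= leq_addr. Qed.

Lemma sum_layers mu (I : {set 'I_n}) N : (forall i, mu i <= N)%N ->
  (\sum_(i in I) mu i = \sum_(c < N) #|[set i in I | (c < mu i)%N]|)%N.
Proof.
move=> h; rewrite (eq_bigr (fun i => \sum_(c < N) (c < mu i)%N)%N); last first.
  move=> i _; rewrite (eq_bigr (fun c : 'I_N => if (c < mu i)%N then 1%N else 0%N)).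
    by rewrite -big_mkcond -(big_ord_widen N (fun=> 1%N) (h i)) sum1_card card_ord.
  by move=> c _; case: ltnP.
rewrite exchange_big /=; apply: eq_bigr => c _.
rewrite -sum1_card big_mkcond [in RHS]big_mkcond /=; apply: eq_bigr => i _.
by rewrite !inE; case: (i \in I); case: ltnP.
Qed.

Lemma topsum_upper mu (I : {set 'I_n}) :
  (forall i j, i \in I -> j \notin I -> (mu j <= mu i)%N) ->
  (topsum mu #|I| <= \sum_(i in I) mu i)%N.
Proof.
move=> up; rewrite (sum_layers I (leq_mdeg mu)) /topsum; apply: leq_sum => c _.
(* If some element of [I] misses layer [c], the layer lies inside [I]; otherwise [I] lies inside the
   layer. *)
case: (boolP [exists i in I, (mu i <= c)%N]) => [/existsP[i /andP[iI ic]]|].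
  apply: leq_trans (geq_minr _ _) _; apply: subset_leq_card; apply/subsetP=> j.
  rewrite !inE => lt_c; rewrite lt_c andbT; apply: contraT => /(up i j iI); lia.
rewrite negb_exists => /forallP h; apply: leq_trans (geq_minl _ _) _.
apply: subset_leq_card; apply/subsetP=> j jI; rewrite inE jI /=.
by have := h j; rewrite jI /=; lia.
Qed.

Lemma topsum_full mu : (topsum mu n <= mdeg mu)%N.
Proof.
have := @topsum_upper mu setT; rewrite cardsT card_ord mdegE.
rewrite (eq_bigl predT); last by move=> i; rewrite inE.
by apply=> i j _; rewrite inE.
Qed.

(** Weak dominance: total degrees may differ, since the interpolation polynomials are not
    homogeneous. *)
Definition dominates mu m : Prop :=
  forall I : {set 'I_n}, (\sum_(i in I) m i <= topsum mu #|I|)%N.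

Lemma dominates_mdeg mu m : dominates mu m -> (mdeg m <= mdeg mu)%N.
Proof.
move=> /(_ setT); rewrite cardsT card_ord => h; apply: leq_trans (topsum_full mu).
by apply: leq_trans h; rewrite mdegE; rewrite [leqRHS](eq_bigl predT) // => i; rewrite inE.
Qed.

Lemma dominates_rearr mu nu m : rearr mu nu -> dominates mu m -> dominates nu m.
Proof. by move=> h d I; rewrite -(topsum_rearr _ h). Qed.

Lemma dominates_mperm mu m (s : 'S_n) : dominates mu m -> dominates mu [multinom m (s j) | j < n].
Proof.
move=> d I; rewrite -(card_imset I (@perm_inj _ s)).
apply: leq_trans (d (s @: I)).
rewrite big_imset /=; last by move=> x y _ _; apply: perm_inj.
by rewrite leq_eqVlt; apply/orP; left; apply/eqP; apply: eq_bigr => i _; rewrite mnmE.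
Qed.

Lemma dominates_swm a b mu m : dominates mu m -> dominates mu (swm a b m).
Proof. exact: dominates_mperm. Qed.

Lemma between_sym a b m m' : between a b m m' -> between b a m m'.
Proof. by case=> h1 h2 h3 h4; split; [move=> l lb la; exact: h1|lia..]. Qed.

Lemma between_sw a b m m' : a != b -> between a b m m' -> between a b (swm a b m) m'.
Proof.
move=> ab [h1 h2 h3 h4]; split; rewrite ?swmL ?swmR; try lia.
by move=> l la lb; rewrite swmD ?h1 // eq_sym.
Qed.

(** By symmetry one may assume that [m a] is the larger exponent and that [I] contains [a] if it
    contains [b]; balancing the two exponents then cannot increase the sum over [I]. *)
Lemma dominates_between a b mu m m' : a != b ->
  dominates mu m -> between a b m m' -> dominates mu m'.
Proof.
move=> ab d bt I.
wlog le_ab : m d bt / (m b <= m a)%N.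
  move=> th; case: (leqP (m b) (m a)) => [/th|h]; first exact.
  by apply: (th (swm a b m)); [apply: dominates_swm|apply: between_sw|rewrite swmL swmR ltnW].
wlog aI : a b ab m d bt le_ab / (b \in I) ==> (a \in I).
  move=> th; case: (boolP ((b \in I) ==> (a \in I))) => [/(th a b ab m d bt)|]; first exact.
  rewrite negb_imply => /andP[bI aI].
  apply: (th b a _ (swm a b m)).
  - by rewrite eq_sym.
  - exact: dominates_swm.
  - exact/between_sym/between_sw.
  - by rewrite swmL swmR.
  - by rewrite bI implybT.
case: bt => h1 h2 h3 h4; apply: leq_trans (d I).
have ba : b != a by rewrite eq_sym.
case: (boolP (a \in I)) aI => aI; last first.
  rewrite implybF => bI; rewrite leq_eqVlt; apply/orP; left; apply/eqP.
  apply: eq_bigr => l lI; apply: h1; first by apply: contraNneq aI => <-.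
  by apply: contraNneq bI => <-.
move=> _; rewrite (bigD1 a) //= [leqRHS](bigD1 a) //=.
case: (boolP (b \in I)) => bI.
  have bI' : (b \in I) && (b != a) by rewrite bI ba.
  rewrite (bigD1 b) //= [in leqRHS](bigD1 b) //= !addnA h2 leq_add2l.
  apply: leq_sum => l /andP[/andP[_ la] lb]; by rewrite h1.
apply: leq_add; first by lia.
apply: leq_sum => l /andP[lI la]; rewrite h1 //.
by apply: contraNneq bI => <-.
Qed.

(** Rearrangements of [mu] are extreme. Say [nu b <= nu a] and [m b <= m a], so that [nu a < m a].
    On the upper set [I] below, [nu] attains the top sum, while [m] agrees with [nu] on [I] except
    at [a], so [m] would exceed it. *)
Lemma dominates_not_between a b mu m nu : a != b -> rearr nu mu ->
  dominates mu m -> ~ between a b m nu.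
Proof.
move=> ab pe d bt.
wlog le_ba : a b ab bt / (nu b <= nu a)%N.
  move=> th; case: (leqP (nu b) (nu a)) => [/(th a b ab bt)|/ltnW] //.
  by apply: (th b a) => //; [rewrite eq_sym|exact: between_sym].
wlog le_ab : m d bt / (m b <= m a)%N.
  move=> th; case: (leqP (m b) (m a)) => [/th|h]; first exact.
  by apply: (th (swm a b m)); [apply: dominates_swm|apply: between_sw|rewrite swmL swmR ltnW].
case: bt => h1 h2 h3 h4.
pose I : {set 'I_n} := [set j | (nu a <= nu j)%N && (j != b)].
have aI : a \in I by rewrite inE leqnn.
have up : (topsum nu #|I| <= \sum_(i in I) nu i)%N.
  apply: topsum_upper => i j; rewrite !inE => /andP[ai _].
  rewrite negb_and negbK => /orP[|/eqP->]; lia.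
have := leq_trans (d I) _; rewrite -(topsum_rearr _ pe) => /(_ _ up).
rewrite (bigD1 a) //= [leqRHS](bigD1 a) //=.
rewrite [X in (_ + X <= _)%N](eq_bigr nu); first by rewrite leq_add2r; lia.
by move=> l /andP[]; rewrite inE => /andP[_ lb] la; rewrite h1.
Qed.

End Compositions.

(** * Reduced words and sorting *)

Section Words.

Variable n : nat.
Implicit Types (mu nu lam m : 'X_{1..n}) (a b : 'I_n) (i : 'I_n.-1) (w : seq 'I_n.-1).

Definition swi i mu := swm (lo_ix i) (hi_ix i) mu.

Lemma inv_sw_desc i mu : (mu (hi_ix i) < mu (lo_ix i))%N -> inv (swi i mu) = (inv mu).+1.
Proof. exact/inv_swm/hi_ixE. Qed.

Lemma inv_sw_asc i mu : (mu (lo_ix i) < mu (hi_ix i))%N -> inv mu = (inv (swi i mu)).+1.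
Proof.
move=> h; have := @inv_sw_desc i (swi i mu); rewrite {3}/swi swmK; apply.
by rewrite swmL swmR.
Qed.

Lemma inv_sw_le i mu : (inv (swi i mu) <= (inv mu).+1)%N.
Proof.
case: (ltngtP (mu (lo_ix i)) (mu (hi_ix i))) => h.
- by rewrite (inv_sw_asc h); lia.
- by rewrite inv_sw_desc.
- by rewrite /swi swm_id.
Qed.

Lemma inv_sw_ge i mu : (inv mu <= (inv (swi i mu)).+1)%N.
Proof. by rewrite -{1}(swmK (lo_ix i) (hi_ix i) mu) inv_sw_le. Qed.

Lemma inv_partition lam : is_partition lam -> inv lam = 0%N.
Proof.
move/partitionP=> h; apply: eq_card0 => -[x y]; rewrite !inE /=.
by case: ltnP => //= /ltnW /h; case: ltnP => //; lia.
Qed.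

Definition wact w lam := foldr swi lam w.

Lemma inv_wact_le w lam : is_partition lam -> (inv (wact w lam) <= size w)%N.
Proof.
move=> pl; elim: w => [|i w IH] /=; first by rewrite inv_partition.
exact: leq_trans (inv_sw_le _ _) _.
Qed.

Lemma cact_word w lam : cact (perm_of_word w) lam = wact w lam.
Proof.
elim: w => [|i w IH] /=; first by apply/mnmP=> j; rewrite mnmE invg1 perm1.
rewrite -/(wact w lam) -IH; apply/mnmP=> j.
by rewrite !mnmE invMg permM tpermV.
Qed.

Lemma sorting_word lam mu : is_partition lam -> rearr mu lam ->
  exists2 w, wact w lam = mu & size w = inv mu.
Proof.
move=> pl; elim/sort_ind: mu => [mu pm h|mu i lt_i IH h].
  by exists [::]; rewrite /= ?inv_partition // (rearr_partition pm pl h).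
have [|w e sz] := IH; first by apply: rearr_trans h; rewrite rearr_sym rearr_swm.
by exists (i :: w); rewrite /= ?e // sz inv_sw_desc.
Qed.

(** The staircase [(n, .., 1)]: its parts are distinct, so its rearrangements stand for permutations
    and Coxeter length becomes [inv]. *)
Definition delta : 'X_{1..n} := [multinom (n - j)%N | j < n].

Lemma delta_partition : is_partition delta.
Proof. by apply/partitionP=> i j; rewrite !mnmE; lia. Qed.

Lemma plength_inv (s : 'S_n) : plength s = inv (cact s delta).
Proof.
rewrite /plength /inv; pose f (p : 'I_n * 'I_n) := (s p.2, s p.1).
have fI : injective f by move=> [x y] [x' y'] [/perm_inj-> /perm_inj->].
rewrite -(card_imset _ fI); apply: eq_card => -[x y]; rewrite !inE /= !mnmE.
apply/imsetP/idP => [[[u v]]|].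
  rewrite inE /= => /andP[h1 h2] [-> ->]; rewrite !permK h2.
  by have := ltn_ord v; lia.
case/andP=> h1 h2; exists ((s^-1 y)%g, (s^-1 x)%g); rewrite ?inE /f /= ?permKV //.
by rewrite h1 andbT; have := ltn_ord (s^-1 y)%g; lia.
Qed.

Lemma cact_rearr (s : 'S_n) lam : rearr (cact s lam) lam.
Proof. by apply/rearrP; exists (s^-1)%g. Qed.

Lemma cact_delta_inj : injective (fun s : 'S_n => cact s delta).
Proof.
move=> s s' /mnmP h; apply: invg_inj; apply/permP=> j; apply: ord_inj.
have := h j; rewrite /cact /= !mnmE; have := ltn_ord (s^-1 j)%g; have := ltn_ord (s'^-1 j)%g.
by move: (nat_of_ord _) (nat_of_ord _); lia.
Qed.

Lemma plength_word_le w : (plength (perm_of_word w) <= size w)%N.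
Proof. by rewrite plength_inv cact_word inv_wact_le // delta_partition. Qed.

(** Sorting [cact s delta] yields a word of the required length, so [red_word] never falls back on
    its default. *)
Lemma red_wordP (s : 'S_n) :
  perm_of_word (red_word s) = s /\ size (red_word s) = plength s.
Proof.
rewrite /red_word; case: pickP => [w /eqP e|h]; first by rewrite size_tuple.
have [w ew sz] := sorting_word delta_partition (cact_rearr s delta).
move: sz; rewrite -plength_inv => /eqP sz.
have /eqP[] := h (Tuple sz); apply: cact_delta_inj => /=.
by rewrite cact_word.
Qed.

(** Each letter raises [inv] by at most one and a sorting word attains [inv mu], so the minimal
    length of a permutation taking [lam] to [mu] is [inv mu]. *)
Lemma red_word_sigma lam mu : is_partition lam -> rearr mu lam ->
  let w := red_word (sigma_of lam mu) in wact w lam = mu /\ size w = inv mu.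
Proof.
move=> pl pe w; have [w' ew' sz'] := sorting_word pl pe.
have [] := red_wordP (sigma_of lam mu); rewrite -/w.
rewrite /sigma_of; case: pickP => [s /andP[/eqP es /forallP mn]|].
  move=> ew sz; have e : wact w lam = mu by rewrite -cact_word ew.
  split=> //; apply/eqP; rewrite eqn_leq -{2}e inv_wact_le // andbT sz -sz'.
  have := mn (perm_of_word w'); rewrite cact_word ew' eqxx /= => /leq_trans; apply.
  exact: plength_word_le.
(* The default value of [sigma_of] cannot occur, because a permutation of minimal length exists. *)
pose Q (s : 'S_n) := cact s lam == mu.
have Q0 : Q (perm_of_word w') by rewrite /Q cact_word ew'.
case: (arg_minnP (@plength n) Q0) => s Qs mn /(_ s).
rewrite -/(Q s) Qs /= => /negP[]; apply/forallP=> s'; apply/implyP; exact: mn.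
Qed.

End Words.

(** * Dominance bounds and extreme coefficients *)

Section LeadingTerms.

Variables (K : fieldType) (n : nat) (t : K).
Implicit Types (mu nu lam m : 'X_{1..n}) (a b : 'I_n) (i : 'I_n.-1) (f g : {mpoly K[n]}).

Definition hki i f := hk t (lo_ix i) (hi_ix i) f.

Definition dominated mu f : Prop := forall m, f@_m != 0 -> dominates mu m.

(** Apart from [mu], only rearrangements with strictly fewer inversions may occur; monomials outside
    the class are unconstrained. *)
Definition unitri mu f : Prop :=
  f@_mu = 1 /\
  forall nu, rearr nu mu -> (inv mu <= inv nu)%N -> nu != mu -> f@_nu = 0.

Lemma dominated_msize mu f : dominated mu f -> (msize f <= (mdeg mu).+1)%N.
Proof.
move=> d; rewrite msizeE; apply/bigmax_leqP_seq => m mf _; rewrite ltnS.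
by apply/dominates_mdeg/d; rewrite -mcoeff_msupp.
Qed.

Lemma dominated_rearr mu nu f : rearr mu nu -> dominated mu f -> dominated nu f.
Proof. by move=> h d m /d; apply: dominates_rearr. Qed.

Lemma dominated_lin mu c f g : dominated mu f -> dominated mu g ->
  dominated mu (c *: f + g).
Proof.
move=> df dg m; rewrite mcoeffD mcoeffZ => h.
case: (eqVneq f@_m 0) => [e|/df//]; apply: dg; apply: contraNneq h => ->.
by rewrite e mulr0 addr0.
Qed.

Lemma dominatedBZ mu c f g : dominated mu f -> dominated mu g ->
  dominated mu (f - c *: g).
Proof. by move=> df dg; rewrite addrC -scaleNr; apply: dominated_lin. Qed.

Lemma dominated0 mu : dominated mu 0.
Proof. by move=> m; rewrite mcoeff0 eqxx. Qed.

Lemma dominated_hk mu a b f : a != b -> dominated mu f -> dominated mu (hk t a b f).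
Proof.
move=> ab d m /(hk_supp ab)[m' /d dm' [->|->|]] //; first exact: dominates_swm.
exact: dominates_between.
Qed.

(** By dominance no intermediate monomial is a rearrangement of [mu], so on these coefficients the
    operator has only two terms. *)
Lemma mcoeff_hk_rearr mu nu a b f : a != b -> dominated mu f -> rearr nu mu ->
  (hk t a b f)@_nu = hk_stay t a b nu * f@_nu
                     + hk_swap t a b (swm a b nu) * f@_(swm a b nu).
Proof.
move=> ab d pe; apply: mcoeff_hk => // m /d dm; exact: dominates_not_between pe dm.
Qed.

(** A swap changes [inv] by at most one. If [inv nu] exceeds [inv mu], then [nu] and its swap both
    have at least [inv mu] inversions, so [f] has coefficient 0 at both unless the swap of [nu] is
    [mu]. *)
Lemma unitri_step mu i c f : dominated mu f -> unitri mu f ->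
  (mu (hi_ix i) < mu (lo_ix i))%N -> unitri (swi i mu) (hki i f - c *: f).
Proof.
move=> d [f1 f0] lt_i; have ab := lo_hi_neq i.
have iE := inv_sw_desc lt_i; have pe : rearr (swi i mu) mu by exact: rearr_swm.
have ne : swi i mu != mu by apply: swm_neq; rewrite neq_ltn lt_i orbT.
have z : f@_(swi i mu) = 0 by apply: f0 => //; rewrite iE leqnSn.
split=> [|nu pnu le_nu ne_nu]; rewrite mcoeffB mcoeffZ.
  rewrite (mcoeff_hk_rearr ab d pe) z !mulr0 add0r subr0 /swi swmK f1 mulr1.
  by rewrite /hk_swap lt_i; case: ltngtP lt_i.
have pe' : rearr nu mu by exact: rearr_trans pnu pe.
rewrite (mcoeff_hk_rearr ab d pe').
have -> : f@_nu = 0.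
  by apply: f0; [|lia|apply: contraTneq le_nu => ->; rewrite iE ltnn].
have -> : f@_(swi i nu) = 0; last by rewrite !mulr0 addr0 subr0.
apply: f0; first exact: rearr_trans (rearr_swm _ _ _) pe'.
  by have := inv_sw_ge i nu; lia.
by apply: contraNneq ne_nu => <-; rewrite /swi swmK.
Qed.

End LeadingTerms.

(** * The span of a unitriangular family, for generic q and q = 1 alike *)

Section Family.

Variables (K : fieldType) (n : nat) (t : K) (E : 'X_{1..n} -> {mpoly K[n]}).
Implicit Types (mu nu lam m : 'X_{1..n}) (i : 'I_n.-1) (f g : {mpoly K[n]}).

Hypothesis E_dominated : forall mu, dominated mu (E mu).
Hypothesis E_unitri : forall mu, unitri mu (E mu).
Hypothesis E_descent : forall mu i, (mu (hi_ix i) < mu (lo_ix i))%N ->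
  exists c, hki t i (E mu) = E (swi i mu) + c *: E mu.
Hypothesis E_flat : forall mu i, mu (lo_ix i) = mu (hi_ix i) ->
  hki t i (E mu) = t *: E mu.

(** The span of the [E nu] for [nu] a rearrangement of [lam]; the degree bound makes the index type
    finite. *)
Definition inU lam f : Prop := exists c : 'X_{1..n} -> K,
  f = \sum_(nu : 'X_{1..n < (mdeg lam).+1} | rearr nu lam) c nu *: E nu.

Lemma inU_E lam nu : rearr nu lam -> inU lam (E nu).
Proof.
move=> pe; exists (fun m => (m == nu)%:R).
have lt_nu : (mdeg nu < (mdeg lam).+1)%N by rewrite (mdeg_rearr pe).
rewrite (bigD1 (BMultinom lt_nu)) //= eqxx scale1r big1 ?addr0 // => m /andP[_ ne].
by rewrite (_ : val m == nu = false) ?scale0r //; apply: negbTE.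
Qed.

Lemma inU_lin lam c f g : inU lam f -> inU lam g -> inU lam (c *: f + g).
Proof.
case=> cf -> [cg ->]; exists (fun m => c * cf m + cg m).
rewrite scaler_sumr -big_split /=; apply: eq_bigr => m _.
by rewrite scalerDl scalerA.
Qed.

Lemma inU0 lam : inU lam 0.
Proof. by exists (fun=> 0); rewrite big1 // => m _; rewrite scale0r. Qed.

Lemma inUZ lam c f : inU lam f -> inU lam (c *: f).
Proof. by move=> h; rewrite -[_ *: _]addr0; apply/inU_lin/inU0. Qed.

Lemma inUD lam f g : inU lam f -> inU lam g -> inU lam (f + g).
Proof. by move=> h; rewrite -[f]scale1r; apply: inU_lin. Qed.

Lemma inUB lam f g : inU lam f -> inU lam g -> inU lam (f - g).
Proof. by move=> hf hg; rewrite -scaleN1r addrC; apply: inU_lin. Qed.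

Lemma inU_sum lam (I : Type) (r : seq I) (P : pred I) (F : I -> {mpoly K[n]}) :
  (forall k, P k -> inU lam (F k)) -> inU lam (\sum_(k <- r | P k) F k).
Proof.
move=> h; apply: (big_ind (inU lam)) => //; [exact: inU0|exact: inUD].
Qed.

Lemma inU_dominated lam f : inU lam f -> dominated lam f.
Proof.
case=> c ->; apply: (big_ind (dominated lam)).
- exact: dominated0.
- by move=> x y hx; rewrite -[x]scale1r; apply: dominated_lin.
- move=> nu pe; rewrite -[_ *: _]addr0; apply/dominated_lin/dominated0.
  exact: dominated_rearr pe _.
Qed.

Lemma inU_inj lam f : inU lam f -> (forall nu, rearr nu lam -> f@_nu = 0) -> f = 0.
Proof.
case=> c -> h.
have c0 (nu : 'X_{1..n < (mdeg lam).+1}) : rearr nu lam -> c nu = 0.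
  (* Induction from many inversions to few: the coefficient at [nu] is [c nu] plus terms from [k]
     with more inversions, whose [c k] is already 0. *)
  have [N] := ubnP (n * n - inv nu); elim: N nu => // N IH nu lt_N pe.
  have := h _ pe; rewrite raddf_sum (bigD1 nu) //= mcoeffZ.
  have [-> _] := E_unitri nu; rewrite mulr1 big1 ?addr0 // => k /andP[pk ne].
  rewrite mcoeffZ; case: (ltnP (inv nu) (inv k)) => lt_k.
    have : (inv k <= n * n)%N.
      by rewrite /inv; apply: leq_trans (max_card _) _; rewrite card_prod card_ord.
    by move=> le_k; rewrite IH ?mul0r //; lia.
  have [_ ->] := E_unitri k; rewrite ?mulr0 //.
    by apply: rearr_trans pe _; rewrite rearr_sym.
  by rewrite eq_sym.
by rewrite big1 // => nu pe; rewrite c0 // scale0r.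
Qed.

Lemma inU_eq lam f g : inU lam f -> inU lam g ->
  (forall nu, rearr nu lam -> f@_nu = g@_nu) -> f = g.
Proof.
move=> hf hg h; apply/eqP; rewrite -subr_eq0; apply/eqP; apply: (inU_inj (inUB hf hg)).
by move=> nu pe; rewrite mcoeffB h // subrr.
Qed.

(** Applying the operator once more to the relation at a descent and using the quadratic relation
    gives the relation at the ascent. *)
Lemma hk_E_ascent mu i c : hki t i (E mu) = E (swi i mu) + c *: E mu ->
  hki t i (E (swi i mu)) = (t - 1 - c) *: E (swi i mu) + (t + c * (t - 1 - c)) *: E mu.
Proof.
move=> e; have -> : E (swi i mu) = hki t i (E mu) - c *: E mu by rewrite e addrK.
rewrite {1}/hki -scaleNr hkD ?lo_hi_neq // hkZ ?lo_hi_neq // {1}/hki hk_quadratic ?lo_hi_neq //.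
rewrite -/(hki t i (E mu)) -!mul_mpolyC !(mpolyCD, mpolyCN, mpolyCM) mpolyC1.
ring.
Qed.

Lemma inU_hk lam i f : inU lam f -> inU lam (hki t i f).
Proof.
case=> c ->; rewrite /hki hk_sum ?lo_hi_neq //; apply: inU_sum => nu pe.
rewrite hkZ ?lo_hi_neq //; apply: inUZ; rewrite -/(hki t i (E nu)).
have pes : rearr (swi i nu) lam by apply: rearr_trans (rearr_swm _ _ _) pe.
case: (ltngtP ((nu : 'X_{1..n}) (lo_ix i)) ((nu : 'X_{1..n}) (hi_ix i))) => h.
- have [|c' e] := @E_descent (swi i nu) i; first by rewrite swmL swmR.
  have := hk_E_ascent e; rewrite /swi swmK => ->.
  by apply: inU_lin; rewrite -?[X in inU _ (_ *: X)]/(E _); [|apply: inUZ]; apply: inU_E.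
- by have [c' ->] := E_descent h; apply: inUD; [|apply: inUZ]; apply: inU_E.
- by rewrite E_flat //; apply: inUZ; apply: inU_E.
Qed.

Definition fword lam w := foldr (hki t) (E lam) w.

(** A letter acting at a descent of [k] moves the coefficient vector concentrated at [k] to the swap
    of [k]. The result depends on [w] only through [wact w lam], by injectivity on coefficients. *)
Lemma fwordP lam w : is_partition lam -> size w = inv (wact w lam) ->
  inU lam (fword lam w) /\
  forall nu, rearr nu lam -> (fword lam w)@_nu = (nu == wact w lam)%:R.
Proof.
move=> pl; elim: w => [|i w IH] /=; rewrite -?/(wact _ lam) => sz.
  split=> [|nu pe]; first exact/inU_E/rearr_refl.
  have [e1 e0] := E_unitri lam; case: eqVneq => [->//|ne].
  by apply: e0 => //; rewrite inv_partition.
have le1 := inv_sw_le i (wact w lam); have le2 := inv_wact_le w pl.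
have {}sz' : size w = inv (wact w lam) by lia.
have [hU hc] := IH sz'; split=> [|nu pe]; first exact: inU_hk.
set k := wact w lam in sz sz' hc *.
(* Since the length equals the final [inv], each letter must raise [inv], so it acts at a
   descent. *)
have lt_k : (k (hi_ix i) < k (lo_ix i))%N.
  case: (ltngtP (k (hi_ix i)) (k (lo_ix i))) => // h.
    by have := inv_sw_asc h; lia.
  by move: sz; rewrite /swi swm_id //; lia.
rewrite /hki (mcoeff_hk_rearr t (lo_hi_neq i) (inU_dominated hU) pe).
have pes : rearr (swi i nu) lam by apply: rearr_trans (rearr_swm _ _ _) pe.
rewrite !hc //; case: (eqVneq nu k) => [->|ne].
  rewrite /hk_stay lt_k; case: ltngtP lt_k => // lt_k _; rewrite mul0r add0r.
  rewrite (negPf (swm_neq _)) ?neq_ltn ?lt_k ?orbT // mulr0.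
  by rewrite eq_sym (negPf (swm_neq _)) // neq_ltn lt_k orbT.
rewrite mulr0 add0r /swi -(can2_eq (@swmK _ _ _) (@swmK _ _ _)).
case: eqP => [->|]; last by rewrite mulr0.
by rewrite /hk_swap lt_k; case: ltngtP lt_k => // _ _; rewrite mulr1.
Qed.

Lemma sum_fword lam (words : 'X_{1..n} -> seq 'I_n.-1) (P : pred 'X_{1..n}) :
  is_partition lam ->
  (forall mu, rearr mu lam -> wact (words mu) lam = mu /\ size (words mu) = inv mu) ->
  let F := \sum_(mu : 'X_{1..n < (mdeg lam).+1} | rearr mu lam && P mu) fword lam (words mu) in
  inU lam F /\ forall nu, rearr nu lam -> F@_nu = (P nu)%:R.
Proof.
move=> pl hW F.
have key mu : rearr mu lam -> inU lam (fword lam (words mu)) /\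
    forall nu, rearr nu lam -> (fword lam (words mu))@_nu = (nu == mu)%:R.
  by move=> pe; have [e sz] := hW _ pe; have := @fwordP lam (words mu) pl; rewrite e; apply.
split=> [|nu pe]; first by apply: inU_sum => mu /andP[pe _]; case: (key mu pe).
have lt_nu : (mdeg nu < (mdeg lam).+1)%N by rewrite (mdeg_rearr pe).
rewrite raddf_sum /= (eq_bigr (fun mu : 'X_{1..n < _} => (nu == mu)%:R)); last first.
  by move=> mu /andP[pm _]; have [_ ->] := key mu pm.
case: (boolP (P nu)) => Pn.
  rewrite (bigD1 (BMultinom lt_nu)) /= ?pe ?Pn // eqxx big1 ?addr0 // => m /andP[_ ne].
  by rewrite eq_sym (_ : val m == nu = false) //; apply: negbTE.
rewrite big1 // => m /andP[_ Pm]; case: eqP => // e.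
by move: Pn; rewrite e Pm.
Qed.

End Family.

(** * Specialization at q = 1 *)

Section Specialization.

Implicit Types (a b : {poly {poly rat}}) (f : Kqt) (g : Kt).

Lemma frac_qt_eq0 a : (frac_qt a == 0) = (a == 0).
Proof. exact: tofrac_eq0. Qed.

Lemma frac_t_eq0 (a : {poly rat}) : (frac_t a == 0) = (a == 0).
Proof. exact: tofrac_eq0. Qed.

Lemma frac_qtX a k : frac_qt (a ^+ k) = frac_qt a ^+ k.
Proof. exact: tofracXn. Qed.

Lemma frac_qtM a b : frac_qt (a * b) = frac_qt a * frac_qt b.
Proof. exact: tofracM. Qed.

Lemma frac_tX (a : {poly rat}) k : frac_t (a ^+ k) = frac_t a ^+ k.
Proof. exact: tofracXn. Qed.

Lemma spec1_den b : b.[1] != 0 -> frac_qt b != 0.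
Proof. by rewrite frac_qt_eq0; apply: contraNneq => ->; rewrite horner0. Qed.

(** Cross-multiplication turns the equality of fractions into a polynomial identity, which can be
    evaluated at [q = 1]. *)
Lemma spec1_uniq f g g' : spec1 f g -> spec1 f g' -> g = g'.
Proof.
case=> a [b [b1 -> ->]] [a' [b' [b'1 e ->]]].
have h : a * b' = a' * b.
  apply/eqP; rewrite -subr_eq0 -frac_qt_eq0 /frac_qt rmorphB !rmorphM /= subr_eq0.
  by rewrite -/(frac_qt _) -/(frac_qt _) -eqr_div ?spec1_den //; apply/eqP.
apply/eqP; rewrite eqr_div ?frac_t_eq0 // /frac_t -!rmorphM /= -!hornerM h.
by rewrite eqxx.
Qed.

Lemma spec1_frac a : spec1 (frac_qt a) (frac_t a.[1]).
Proof.
exists a, 1; rewrite hornerC oner_eq0; split=> //.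
  by rewrite /frac_qt rmorph1 divr1.
by rewrite /frac_t rmorph1 divr1.
Qed.

Lemma spec1_0 : spec1 0 0.
Proof. by have := spec1_frac 0; rewrite horner0 /frac_qt /frac_t !rmorph0. Qed.

Lemma spec1_1 : spec1 1 1.
Proof. by have := spec1_frac 1; rewrite hornerC /frac_qt /frac_t !rmorph1. Qed.

Lemma spec1_q : spec1 qK 1.
Proof. by have := spec1_frac 'X; rewrite hornerX /frac_t rmorph1. Qed.

Lemma spec1_t : spec1 tK tQ.
Proof. by have := spec1_frac ('X)%:P; rewrite hornerC. Qed.

Lemma spec1D f f' g g' : spec1 f g -> spec1 f' g' -> spec1 (f + f') (g + g').
Proof.
case=> a [b [b1 -> ->]] [a' [b' [b'1 -> ->]]]; exists (a * b' + a' * b), (b * b').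
rewrite hornerM mulf_neq0 //; split=> //.
  by rewrite addf_div ?spec1_den // /frac_qt rmorphD !rmorphM.
by rewrite addf_div ?frac_t_eq0 // /frac_t hornerD !hornerM rmorphD !rmorphM.
Qed.

Lemma spec1M f f' g g' : spec1 f g -> spec1 f' g' -> spec1 (f * f') (g * g').
Proof.
case=> a [b [b1 -> ->]] [a' [b' [b'1 -> ->]]]; exists (a * a'), (b * b').
rewrite hornerM mulf_neq0 //; split=> //.
  by rewrite mulf_div /frac_qt !rmorphM.
by rewrite mulf_div /frac_t !hornerM !rmorphM.
Qed.

Lemma spec1N f g : spec1 f g -> spec1 (- f) (- g).
Proof.
case=> a [b [b1 -> ->]]; exists (- a), b; split=> //.
  by rewrite /frac_qt rmorphN mulNr.
by rewrite /frac_t hornerN rmorphN mulNr.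
Qed.

Lemma spec1B f f' g g' : spec1 f g -> spec1 f' g' -> spec1 (f - f') (g - g').
Proof. by move=> h h'; apply/spec1D/spec1N. Qed.

Lemma spec1V f g : spec1 f g -> g != 0 -> spec1 f^-1 g^-1.
Proof.
case=> a [b [b1 -> ->]] nz; exists b, a; rewrite !invf_div; split=> //.
by apply: contraNneq nz => ->; rewrite /frac_t rmorph0 mul0r.
Qed.

Lemma spec1X f g k : spec1 f g -> spec1 (f ^+ k) (g ^+ k).
Proof.
by move=> h; elim: k => [|k IH]; [rewrite !expr0; exact: spec1_1|rewrite !exprS; exact: spec1M].
Qed.

Lemma qt_eq i j k l : qK ^+ i * tK ^+ j = qK ^+ k * tK ^+ l -> i = k /\ j = l.
Proof.
rewrite /qK /tK -!frac_qtX -!frac_qtM => /eqP; rewrite tofrac_eq -!polyC_exp => /eqP h.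
have c r : ('X^i * ('X^j)%:P : {poly {poly rat}})`_r
         = ('X^k * ('X^l)%:P : {poly {poly rat}})`_r by rewrite h.
move: (c i); rewrite !coefMC !coefXn eqxx mul1r; case: eqP => [->|_].
  by rewrite mul1r => /(congr1 (fun p : {poly rat} => size p)); rewrite !size_polyXn => -[].
by rewrite mul0r => /eqP; rewrite -size_poly_eq0 size_polyXn.
Qed.

Lemma qK_neq0 : qK != 0.
Proof. by rewrite frac_qt_eq0 polyX_eq0. Qed.

Lemma tK_neq0 : tK != 0.
Proof. by rewrite frac_qt_eq0 polyC_eq0 polyX_eq0. Qed.

Lemma tQ_neq0 : tQ != 0.
Proof. by rewrite frac_t_eq0 polyX_eq0. Qed.

Lemma tQ_expI : injective (fun k => tQ ^+ k).
Proof.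
move=> i j; rewrite /= /tQ -!frac_tX => /eqP; rewrite tofrac_eq => /eqP.
by move/(congr1 (fun p : {poly rat} => size p)); rewrite !size_polyXn => -[].
Qed.

End Specialization.

(** * Coefficientwise specialization of polynomials *)

Section PolySpecialization.

Variable n : nat.
Implicit Types (f : {mpoly Kqt[n]}) (g : {mpoly Kt[n]}).

Lemma mspec1_uniq f g g' : mspec1 f g -> mspec1 f g' -> g = g'.
Proof. by move=> h h'; apply/mpolyP=> m; apply: spec1_uniq (h m) (h' m). Qed.

Lemma mspec1_0 : @mspec1 n 0 0.
Proof. by move=> m; rewrite !mcoeff0; exact: spec1_0. Qed.

Lemma mspec1D f f' g g' : mspec1 f g -> mspec1 f' g' -> mspec1 (f + f') (g + g').
Proof. by move=> h h' m; rewrite !mcoeffD; apply: spec1D. Qed.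

Lemma mspec1Z c d f g : spec1 c d -> mspec1 f g -> mspec1 (c *: f) (d *: g).
Proof. by move=> h h' m; rewrite !mcoeffZ; apply: spec1M. Qed.

Lemma mspec1N f g : mspec1 f g -> mspec1 (- f) (- g).
Proof. by move=> h m; rewrite !mcoeffN; apply: spec1N. Qed.

Lemma mspec1B f f' g g' : mspec1 f g -> mspec1 f' g' -> mspec1 (f - f') (g - g').
Proof. by move=> h h'; apply/mspec1D/mspec1N. Qed.

Lemma mspec1_sum (I : Type) (r : seq I) (P : pred I)
    (F : I -> {mpoly Kqt[n]}) (G : I -> {mpoly Kt[n]}) :
  (forall i, P i -> mspec1 (F i) (G i)) ->
  mspec1 (\sum_(i <- r | P i) F i) (\sum_(i <- r | P i) G i).
Proof.
by move=> h; apply: (big_ind2 (@mspec1 n)) => //; [exact: mspec1_0|move=> *; exact: mspec1D].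
Qed.

Lemma mspec1_X (m : 'X_{1..n}) : mspec1 'X_[m] 'X_[m].
Proof. by move=> k; rewrite !mcoeffX; case: eqP => _; [exact: spec1_1|exact: spec1_0]. Qed.

Lemma mspec1_C c d : spec1 c d -> @mspec1 n c%:MP d%:MP.
Proof.
move=> h; rewrite -[c%:MP]mulr1 -[d%:MP]mulr1 !mul_mpolyC; apply: mspec1Z => //.
by rewrite -!mpolyX0; exact: mspec1_X.
Qed.

Lemma mspec1_1 : @mspec1 n 1 1.
Proof. by rewrite -!mpolyX0; exact: mspec1_X. Qed.

Lemma mspec1M f f' g g' : mspec1 f g -> mspec1 f' g' -> mspec1 (f * f') (g * g').
Proof.
move=> h h' m; rewrite !mcoeffM; apply: (big_ind2 spec1); first exact: spec1_0.
  by move=> *; exact: spec1D.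
by move=> k _; apply: spec1M.
Qed.

Lemma mspec1_prod (I : Type) (r : seq I) (P : pred I)
    (F : I -> {mpoly Kqt[n]}) (G : I -> {mpoly Kt[n]}) :
  (forall i, P i -> mspec1 (F i) (G i)) ->
  mspec1 (\prod_(i <- r | P i) F i) (\prod_(i <- r | P i) G i).
Proof.
by move=> h; apply: (big_ind2 (@mspec1 n)) => //; [exact: mspec1_1|move=> *; exact: mspec1M].
Qed.

Lemma mspec1_hkX a b (m : 'X_{1..n}) : mspec1 (hkX tK a b m) (hkX tQ a b m).
Proof.
have h1 : spec1 (tK - 1) (tQ - 1) by apply/spec1B; [exact: spec1_t|exact: spec1_1].
have h2 : spec1 (1 - tK) (1 - tQ) by apply/spec1B; [exact: spec1_1|exact: spec1_t].
rewrite /hkX; apply: mspec1D; first apply: mspec1D.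
- apply: mspec1Z (mspec1_X _); rewrite /hk_stay; case: ifP => _; first exact: spec1_t.
  by case: ifP => _ //; exact: spec1_0.
- apply: mspec1Z (mspec1_X _); rewrite /hk_swap; case: ifP => _; first exact: spec1_0.
  by case: ifP => _; [exact: spec1_1|exact: spec1_t].
- apply: mspec1Z; first by rewrite /hk_mid; case: ifP.
  by apply: mspec1_sum => j _; exact: mspec1_X.
Qed.

Lemma hk_X (K : fieldType) (t : K) a b (m : 'X_{1..n}) : hk t a b 'X_[m] = hkX t a b m.
Proof. by rewrite /hk msuppX big_seq1 mcoeffX eqxx scale1r. Qed.

Lemma mspec1_hk a b f g : a != b -> mspec1 f g -> mspec1 (hk tK a b f) (hk tQ a b g).
Proof.
(* The supports of [f] and [g] may differ, so both are expanded over all monomials below a common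
   degree bound. *)
move=> ab h; pose N := maxn (msize f) (msize g).
rewrite (mpolywE (leq_maxl _ _ : (msize f <= N)%N)).
rewrite (mpolywE (leq_maxr _ _ : (msize g <= N)%N)) !hk_sum //.
apply: mspec1_sum => m _; rewrite !hkZ // !hk_X; apply: mspec1Z => //.
exact: mspec1_hkX.
Qed.

Lemma mspec1_msym (s : 'S_n) f g : mspec1 f g -> mspec1 (msym s f) (msym s g).
Proof. by move=> h m; rewrite !mcoeff_sym. Qed.

Lemma HeckeE i f : Hecke i f = hki tK i f.
Proof.
have ab := lo_hi_neq i; apply/esym; apply: hkP => //.
have ex := dvd_difference f ab; have := epsilon_spec (inhabits 0) _ ex.
rewrite -/(sadj i) -/(spoly i f) -/(ddiff i f) => e.
rewrite /Hecke -!mul_mpolyC mulrBr [_ * (_ * ddiff i f)]mulrCA e !mpolyCD !mpolyCN mpolyC1.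
ring.
Qed.

End PolySpecialization.

(** * Products of linear factors *)

Section LinearProducts.

Variables (K : fieldType) (n : nat).
Implicit Types (S : {set 'I_n}) (c : 'I_n -> K) (f g : {mpoly K[n]}) (m nu : 'X_{1..n}).

Lemma mcoeffXUM i g m :
  ('X_i * g)@_m = if (0 < m i)%N then g@_(m - U_(i))%MM else 0.
Proof.
case: ltnP => h.
  have {1}-> : m = (U_(i) + (m - U_(i)))%MM.
    by apply/mnmP=> j; rewrite mnmDE mnmBE mnm1E; case: eqP h => [<-|_]; lia.
  by rewrite mulrC mcoeffMX.
apply: memN_msupp_eq0; rewrite mulrC (perm_mem (msuppMX _ _)).
by apply/mapP => -[k _ e]; move: h; rewrite e mnmDE mnm1E eqxx; lia.
Qed.

Definition linprod S c : {mpoly K[n]} := \prod_(i in S) ('X_i - (c i)%:MP).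

Lemma linprod_supp S c f m : (linprod S c * f)@_m != 0 ->
  exists2 m', f@_m' != 0 & forall i, (m i <= m' i + (i \in S))%N.
Proof.
have [N] := ubnP #|S|; elim: N S m => // N IH S m.
case: (set_0Vmem S) => [->|[i iS]] lt_N.
  by rewrite /linprod big_set0 mul1r => h; exists m => // j; rewrite leq_addr.
rewrite /linprod (big_setD1 i) //= -mulrA -/(linprod (S :\ i) c).
rewrite mulrBl mcoeffB mcoeffXUM mcoeffCM => h.
have lt_N' : (#|S :\ i| < N)%N by move: lt_N; rewrite (cardsD1 i S) iS; lia.
case: (eqVneq (linprod (S :\ i) c * f)@_m 0) => [e|/(IH _ _ lt_N')[m' fm le]].
  move: h; rewrite e mulr0 subr0; case: ltnP; last by rewrite eqxx.
  move=> mi /(IH _ _ lt_N')[m' fm le]; exists m' => // j.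
  have := le j; rewrite mnmBE mnm1E !inE; case: (eqVneq i j) => [<-|_] /=; rewrite ?iS; lia.
exists m' => // j; have := le j; rewrite !inE; case: (j \in S); last by rewrite andbF.
by case: (j == i) => /=; lia.
Qed.

Definition oneS S : 'X_{1..n} := [multinom (i \in S : nat) | i < n].

Lemma mdeg_oneS S : mdeg (oneS S) = #|S|.
Proof.
rewrite mdegE -sum1_card [RHS]big_mkcond; apply: eq_bigr => i _.
by rewrite mnmE; case: (i \in S).
Qed.

Lemma linprod_mdeg S c f d : (forall m, f@_m != 0 -> (mdeg m <= d)%N) ->
  forall m, (linprod S c * f)@_m != 0 -> (mdeg m <= d + #|S|)%N.
Proof.
move=> h m /linprod_supp[m' /h le_d le]; apply: leq_trans (leq_add le_d (leqnn _)).
rewrite -mdeg_oneS -mdegD !mdegE; apply: leq_sum => i _.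
by rewrite mnmDE mnmE.
Qed.

(** In the top degree [d + #|S|] the constants [c i] cannot contribute, so the product acts like
    multiplication by the monomial of [S]. *)
Lemma mcoeff_linprod S c f d nu : (forall m, f@_m != 0 -> (mdeg m <= d)%N) ->
  mdeg nu = (d + #|S|)%N ->
  (linprod S c * f)@_nu =
    if [forall i in S, (0 < nu i)%N] then f@_(nu - oneS S)%MM else 0.
Proof.
move=> hf; have [N] := ubnP #|S|; elim: N S nu => // N IH S nu.
case: (set_0Vmem S) => [->|[i iS]] lt_N nu_d.
  rewrite /linprod big_set0 mul1r ifT; last by apply/forallP=> i; rewrite inE.
  by congr (_@__); apply/mnmP=> j; rewrite mnmBE mnmE inE subn0.
have cS : #|S| = #|S :\ i|.+1 by rewrite (cardsD1 i S) iS.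
rewrite /linprod (big_setD1 i) //= -mulrA -/(linprod (S :\ i) c).
rewrite mulrBl mcoeffB mcoeffXUM mcoeffCM.
have -> : (linprod (S :\ i) c * f)@_nu = 0.
  apply/eqP; apply: contraT => /(linprod_mdeg hf); rewrite nu_d cS; lia.
rewrite mulr0 subr0; case: ltnP => nu_i; last first.
  by rewrite ifF //; apply/negP => /forallP/(_ i); rewrite iS /=; lia.
rewrite IH; last 2 first.
- by move: lt_N; rewrite cS; lia.
- have e : nu = (U_(i) + (nu - U_(i)))%MM.
    by apply/mnmP=> j; rewrite mnmDE mnmBE mnm1E; case: eqP nu_i => [<-|_]; lia.
  by move: nu_d; rewrite {1}e mdegD mdeg1 cS; lia.
have -> : [forall j in S :\ i, (0 < (nu - U_(i))%MM j)%N] = [forall j in S, (0 < nu j)%N].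
  apply: eq_forallb => j; rewrite mnmBE mnm1E !inE (eq_sym i).
  by case: eqP => [->|_] /=; rewrite ?iS ?nu_i // subn0.
case: ifP => // _; congr (_@__); apply/mnmP=> j; rewrite !mnmBE mnm1E !mnmE !inE.
by case: (eqVneq i j) => [<-|_] /=; rewrite ?iS; lia.
Qed.

Lemma mcoeff_sum_scaleX f (G : 'X_{1..n} -> K) k :
  (\sum_(m <- msupp f) (f@_m * G m) *: 'X_[m])@_k = f@_k * G k.
Proof.
rewrite raddf_sum /= -(sum_msupp_eq f); apply: eq_bigr => m _.
by rewrite mcoeffZ mcoeffX mulrA.
Qed.

End LinearProducts.

(** * Cyclic rotation and lowering of compositions *)

Section Rotation.

Variables (n k : nat) (kn : (k <= n)%N).
Implicit Types (i j l : 'I_n) (lam mu nu : 'X_{1..n}).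

Definition rotf j : 'I_n := insubd j (if (j + k < n)%N then j + k else j + k - n)%N.

Lemma rotfE j : rotf j = (if (j + k < n)%N then j + k else j + k - n)%N :> nat.
Proof.
rewrite val_insubd; have := ltn_ord j.
by case: (ltnP (j + k) n) => h1 h2; case: ltnP => //; lia.
Qed.

Lemma rotf_inj : injective rotf.
Proof.
move=> i j /(congr1 (@nat_of_ord n)); rewrite !rotfE => h; apply: ord_inj; move: h.
have := ltn_ord i; have := ltn_ord j.
by case: (ltnP (i + k) n); case: (ltnP (j + k) n); lia.
Qed.

Definition rho : 'S_n := perm rotf_inj.

Lemma rhoE j : rho j = (if (j + k < n)%N then j + k else j + k - n)%N :> nat.
Proof. by rewrite permE rotfE. Qed.

Lemma rho_lt j : (rho j < k)%N = (n - k <= j)%N.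
Proof. by rewrite rhoE; have := ltn_ord j; case: (ltnP (j + k) n); lia. Qed.

Definition front : {set 'I_n} := [set i : 'I_n | (i < k)%N].

Lemma card_front : #|front| = k.
Proof.
by rewrite -sum1dep_card -(big_ord_widen n (fun=> 1%N) kn) sum1_card card_ord.
Qed.

(** The composition [(nu_k, .., nu_(n-1), nu_0 - 1, .., nu_(k-1) - 1)], which [raise] undoes on the
    level of interpolation polynomials. *)
Definition lower nu : 'X_{1..n} := [multinom (nu (rho j) - (rho j < k))%N | j < n].

Lemma lowerE nu : lower nu = [multinom (nu - oneS front)%MM (rho j) | j < n].
Proof. by apply/mnmP=> j; rewrite !mnmE inE. Qed.

(** Ties favour later positions, so losing one unit exactly offsets the move to the back and all
    comparisons are preserved. *)
Lemma kidx_lower nu j : (forall i, (i < k)%N -> (0 < nu i)%N) ->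
  kidx (lower nu) j = kidx nu (rho j).
Proof.
move=> pos; apply: kidx_reindex => l i; rewrite /beats !mnmE.
have := pos (rho l); have := pos (rho i); rewrite !rhoE.
have := ltn_ord l; have := ltn_ord i.
case: (ltnP (l + k) n) => h1; case: (ltnP (i + k) n) => h2; lia.
Qed.

Lemma tilde_lower nu j : (forall i, (i < k)%N -> (0 < nu i)%N) ->
  tilde (lower nu) j = tilde nu (rho j) / qK ^+ (rho j < k)%N.
Proof.
move=> pos; rewrite /tilde kidx_lower // mnmE mulrAC; congr (_ / _).
case: ltnP => h; last by rewrite subn0 divr1.
rewrite -[in RHS](subnK (pos _ h)) exprD expr1 mulfK ?qK_neq0 //.
Qed.

Lemma lower_mdeg nu : (forall i, (i < k)%N -> (0 < nu i)%N) ->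
  mdeg nu = (mdeg (lower nu) + k)%N.
Proof.
move=> pos; rewrite lowerE mdeg_mperm -[X in (_ + X)%N]card_front -mdeg_oneS -mdegD; congr mdeg.
apply/mnmP=> i; rewrite mnmDE mnmBE mnmE inE; case: ltnP => [/pos|]; lia.
Qed.

Lemma lower_inj nu lam : (forall i, (i < k)%N -> (0 < nu i)%N) ->
  (forall i, (i < k)%N -> (0 < lam i)%N) -> lower nu = lower lam -> nu = lam.
Proof.
move=> pn pl /mnmP h; apply/mnmP=> i; have := h (rho^-1 i)%g; rewrite !mnmE permKV.
by have := pn i; have := pl i; case: ltnP => h1; [move=> /(_ isT) h2 /(_ isT) h3|move=> _ _]; lia.
Qed.

(** The first [n - k] parts of [lower nu] are zero, and each forms a new pair with every positive
    part. The shift is constant on a rearrangement class, so comparisons of [inv] survive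
    lowering. *)
Lemma inv_lower nu : (forall i, (0 < nu i)%N = (i < k)%N) ->
  inv (lower nu) = (inv nu + (n - k) * conjp (lower nu) 1)%N.
Proof.
move=> hs; pose f (p : 'I_n * 'I_n) := (rho p.1, rho p.2).
have fI : injective f by move=> [x y] [x' y'] [/perm_inj-> /perm_inj->].
pose A := [set p : 'I_n * 'I_n | (p.1 < p.2)%N && (lower nu p.1 < lower nu p.2)%N].
pose B := f @^-1: [set p : 'I_n * 'I_n | (p.1 < p.2)%N && (nu p.1 < nu p.2)%N].
pose C := setX [set j : 'I_n | (j < n - k)%N] [set j | (1 <= lower nu j)%N].
have -> : inv nu = #|B|.
  rewrite /inv /B; apply/esym/on_card_preimset.
  exists (fun p => (rho^-1 p.1, rho^-1 p.2)%g) => -[x y] _;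
    by rewrite /f /= ?permK ?permKV.
have -> : ((n - k) * conjp (lower nu) 1 = #|C|)%N.
  rewrite cardsX; congr (_ * _)%N.
  rewrite -sum1dep_card -(big_ord_widen n (fun=> 1%N) (leq_subr k n)).
  by rewrite sum1_card card_ord.
rewrite /inv -/A -cardsUI [X in (_ + X)%N](_ : _ = 0%N) ?addn0; last first.
  apply: eq_card0 => -[x y]; rewrite !inE /= !mnmE; have := hs (rho x); have := hs (rho y).
  have := rho_lt x; have := rho_lt y; rewrite !rhoE.
  by have := ltn_ord x; have := ltn_ord y; case: (ltnP (x + k)); case: (ltnP (y + k)); lia.
apply: eq_card => -[x y]; rewrite !inE /= !mnmE; have := hs (rho x); have := hs (rho y).
rewrite !rhoE; have := ltn_ord x; have := ltn_ord y.
by case: (ltnP (x + k)); case: (ltnP (y + k)); lia.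
Qed.

Lemma lower_rearr nu lam : (forall i, (0 < nu i)%N = (i < k)%N) ->
  (forall i, (0 < lam i)%N = (i < k)%N) -> rearr nu lam -> rearr (lower nu) (lower lam).
Proof.
move=> hn hl /rearrP[s e]; apply/rearrP; exists (rho * s * rho^-1)%g.
have pE (m : 'X_{1..n}) j : (forall i, (0 < m i)%N = (i < k)%N) -> lower m j = (m (rho j)).-1.
  by move=> h; rewrite mnmE -h; case: (m (rho j)) => //= u; rewrite subn1.
apply/mnmP=> j; rewrite pE // mnmE pE // !permM permKV e mnmE.
by [].
Qed.

Lemma conjp_lower lam c : (forall i, (0 < lam i)%N = (i < k)%N) ->
  conjp lam c.+2 = conjp (lower lam) c.+1.
Proof.
move=> hl; rewrite /conjp -[RHS](card_imset _ (@perm_inj _ rho)); apply: eq_card => x.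
rewrite inE; apply/idP/imsetP => [h|[y]].
  exists (rho^-1 x)%g; last by rewrite permKV.
  by rewrite inE mnmE permKV -hl; lia.
by rewrite inE mnmE => h ->; move: h; rewrite -hl; lia.
Qed.

End Rotation.

Lemma supp_rearr n (nu lam : 'X_{1..n}) k : (forall i : 'I_n, (0 < lam i)%N = (i < k)%N) ->
  rearr nu lam -> (forall i : 'I_n, (i < k)%N -> (0 < nu i)%N) ->
  forall i : 'I_n, (0 < nu i)%N = (i < k)%N.
Proof.
move=> hl /(conjp_rearr 1) e pos.
have h : [set j | (1 <= lam j)%N] = [set j | (1 <= nu j)%N].
  apply/eqP; rewrite eqEcard -/(conjp lam 1) -/(conjp nu 1) e leqnn andbT.
  by apply/subsetP=> j; rewrite !inE hl; apply: pos.
by move=> i; have /setP/(_ i) := h; rewrite !inE hl.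
Qed.

(** Here [lam] is [mu] with a new first column, which contributes one more layer to the sum. *)
Lemma topsum_up n (lam mu : 'X_{1..n}) r :
  (forall c, conjp lam c.+2 = conjp mu c.+1) -> mdeg lam = (mdeg mu + conjp lam 1)%N ->
  (topsum mu r + minn r (conjp lam 1) <= topsum lam r)%N.
Proof.
move=> hc e; rewrite /topsum; case: (posnP (conjp lam 1)) => k0.
  rewrite k0 minn0 addn0 big1 // => c _; rewrite -hc.
  rewrite (_ : conjp lam c.+2 = 0%N) ?minn0 //; apply/eqP; rewrite -leqn0 -[leqRHS]k0.
  by apply: subset_leq_card; apply/subsetP=> j; rewrite !inE; lia.
have -> : mdeg lam = (mdeg mu + (conjp lam 1).-1).+1 by rewrite e; lia.
rewrite big_ord_recl addnC leq_add2l.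
rewrite (big_ord_widen _ (fun c => minn r (conjp mu c.+1)) (leq_addr (conjp lam 1).-1 _)).
rewrite big_mkcond; apply: leq_sum => c _; rewrite -hc.
by case: ifP.
Qed.

(** * Interpolation polynomials *)

Lemma hecke_point_value (K : fieldType) (t x y P Q : K) : x - y != 0 ->
  (1 - t) * y * P + (t * x - y) * Q
  = (x - y) * ((1 - t) * y / (x - y) * P + (t * x - y) / (x - y) * Q).
Proof. by move=> h; field. Qed.

Lemma hecke_point_value_flat (K : fieldType) (t x P Q : K) :
  (1 - t) * (t * x) * P + (t * x - t * x) * Q = (x - t * x) * (t * P).
Proof. ring. Qed.

Section Interpolation.

Variable n : nat.
Implicit Types (i : 'I_n.-1) (lam mu nu : 'X_{1..n}) (p : {mpoly Kqt[n]}).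

Lemma tildeB_neq0 nu (a b : 'I_n) : a != b -> tilde nu a - tilde nu b != 0.
Proof.
move=> ab; rewrite subr_eq0 /tilde eqr_div ?expf_neq0 ?tK_neq0 //.
by apply: contraNneq (kidx_neq nu ab) => /qt_eq[_ ->].
Qed.

Lemma tilde_sw nu i : nu (lo_ix i) != nu (hi_ix i) ->
  tilde (swi i nu) =1 tilde nu \o tperm (lo_ix i) (hi_ix i).
Proof. by move=> ne j; rewrite /tilde /= swmE kidx_swm ?hi_ixE. Qed.

Lemma tilde_flat nu i : nu (lo_ix i) = nu (hi_ix i) ->
  tK * tilde nu (lo_ix i) = tilde nu (hi_ix i).
Proof.
move=> e; rewrite /tilde e (kidx_eq (hi_ixE i) e) exprS invfM.
by rewrite mulrCA mulVKf ?tK_neq0.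
Qed.

(** The multiple of [p] at a node that enters [T_i p] there; subtracting it cancels the value at
    [tilde mu]. *)
Definition hk_coef (v : 'I_n -> Kqt) i : Kqt :=
  (1 - tK) * v (hi_ix i) / (v (lo_ix i) - v (hi_ix i)).

Lemma meval_hki p nu i : nu (lo_ix i) != nu (hi_ix i) ->
  (hki tK i p).@[tilde nu] = hk_coef (tilde nu) i * p.@[tilde nu]
    + (tK * tilde nu (lo_ix i) - tilde nu (hi_ix i)) / (tilde nu (lo_ix i) - tilde nu (hi_ix i))
      * p.@[tilde (swi i nu)].
Proof.
move=> ne; have d0 := tildeB_neq0 nu (lo_hi_neq i).
rewrite (meval_eq _ (tilde_sw ne)); apply: (mulfI d0).
rewrite (meval_hk tK p (tilde nu) (lo_hi_neq i)) /hk_coef.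
exact: hecke_point_value.
Qed.

(** Equal adjacent parts give [t x_a = x_b] at the node, so the value at the swapped point drops
    out. *)
Lemma meval_hki_flat p nu i : nu (lo_ix i) = nu (hi_ix i) ->
  (hki tK i p).@[tilde nu] = tK * p.@[tilde nu].
Proof.
move=> e; have d0 := tildeB_neq0 nu (lo_hi_neq i); apply: (mulfI d0).
rewrite (meval_hk tK p (tilde nu) (lo_hi_neq i)) -(tilde_flat e).
exact: hecke_point_value_flat.
Qed.

Definition vanishing mu p : Prop :=
  forall nu, (mdeg nu <= mdeg mu)%N -> nu != mu -> p.@[tilde nu] = 0.

(** The invariant carried through the construction; beyond the defining conditions it records
    dominance, unitriangularity, nonvanishing at the own node and regularity at [q = 1]. *)
Definition interpolant mu p : Prop :=
  [/\ dominated mu p, unitri mu p, vanishing mu p, p.@[tilde mu] != 0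
    & exists g, mspec1 p g].

Lemma spec1_tilde mu (j : 'I_n) : spec1 (tilde mu j) (tQ ^- kidx mu j).
Proof.
rewrite -[tQ ^- _]mul1r -(expr1n _ (mu j)); apply: spec1M.
  exact/spec1X/spec1_q.
by apply: spec1V; [exact/spec1X/spec1_t|rewrite expf_neq0 ?tQ_neq0].
Qed.

Definition hk_coef1 mu i : Kt :=
  (1 - tQ) * tQ ^- kidx mu (hi_ix i) / (tQ ^- kidx mu (lo_ix i) - tQ ^- kidx mu (hi_ix i)).

Lemma spec1_hk_coef mu i : spec1 (hk_coef (tilde mu) i) (hk_coef1 mu i).
Proof.
apply: spec1M.
  by apply: spec1M (spec1_tilde _ _); apply: spec1B; [exact: spec1_1|exact: spec1_t].
apply: spec1V; first by apply: spec1B; exact: spec1_tilde.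
rewrite subr_eq0; apply: contra (kidx_neq mu (lo_hi_neq i)) => /eqP/invr_inj h.
by apply/eqP/tQ_expI.
Qed.

(** The value at [nu] combines those of [p] at [nu] and its swap. It can be nonzero only at [mu],
    where the subtracted term cancels it, and at [swi i mu]. *)
Lemma interpolant_sw mu p i : (mu (hi_ix i) < mu (lo_ix i))%N -> interpolant mu p ->
  interpolant (swi i mu) (hki tK i p - hk_coef (tilde mu) i *: p).
Proof.
move=> lt_i [dom tri van nz [g pg]]; have ab := lo_hi_neq i.
have ne_mu : mu (lo_ix i) != mu (hi_ix i) by rewrite neq_ltn lt_i orbT.
split.
- apply: (dominated_rearr (mu := mu)); first by rewrite rearr_sym rearr_swm.
  apply: dominatedBZ; [exact: dominated_hk|exact: dom].
- exact: unitri_step.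
- move=> nu; rewrite mdeg_swm => le_nu ne; rewrite mevalB mevalZ.
  case: (eqVneq (nu (lo_ix i)) (nu (hi_ix i))) => fl.
    rewrite meval_hki_flat // van ?mulr0 ?subr0 //.
    by apply: contra_eq_neq fl => ->.
  rewrite meval_hki // (van (swi i nu)) ?mdeg_swm //; last first.
    by apply: contraNneq ne => <-; rewrite /swi swmK.
  rewrite mulr0 addr0; case: (eqVneq nu mu) => [->|nm]; first by rewrite subrr.
  by rewrite van // !mulr0 subrr.
- have ne_s : swi i mu (lo_ix i) != swi i mu (hi_ix i) by rewrite swmL swmR eq_sym.
  have vz : p.@[tilde (swi i mu)] = 0.
    by apply: van; [rewrite mdeg_swm|exact: swm_neq].
  have ss : swi i (swi i mu) = mu by exact: swmK.
  rewrite mevalB mevalZ (meval_hki _ ne_s) vz ss !mulr0 add0r subr0.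
  apply: mulf_neq0 => [|//]; apply: mulf_neq0; last first.
    by rewrite invr_eq0; exact/tildeB_neq0/lo_hi_neq.
  (* The factor [t x_a - x_b] is nonzero at this node because the two powers of [q] differ. *)
  rewrite !(tilde_sw ne_mu) /= tpermL tpermR subr_eq0 /tilde mulrA.
  rewrite eqr_div ?expf_neq0 ?tK_neq0 //; apply/eqP => h; move/eqP: ne_mu; apply.
  have [] // := @qt_eq (mu (lo_ix i)) (kidx mu (hi_ix i)) (mu (hi_ix i)) (kidx mu (lo_ix i)).+1.
  by rewrite -h exprS mulrCA mulrA.
- exists (hki tQ i g - hk_coef1 mu i *: g); apply: mspec1B; first exact: mspec1_hk.
  by apply: mspec1Z => //; exact: spec1_hk_coef.
Qed.

(** Substitution of [x_i / q] for the first [k] variables, written on coefficients so that it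
    visibly becomes the identity at [q = 1]. *)
Definition qscale (k : nat) p : {mpoly Kqt[n]} :=
  \sum_(m <- msupp p) (p@_m * qK ^- (\sum_(i : 'I_n | (i < k)%N) m i)) *: 'X_[m].

Lemma mcoeff_qscale k p m :
  (qscale k p)@_m = p@_m / qK ^+ (\sum_(i : 'I_n | (i < k)%N) m i).
Proof. exact: (mcoeff_sum_scaleX p (fun m => qK ^- (\sum_(i : 'I_n | (i < k)%N) m i))). Qed.

Lemma meval_qscale k p (v : 'I_n -> Kqt) :
  (qscale k p).@[v] = p.@[fun i : 'I_n => v i / qK ^+ (i < k)%N].
Proof.
rewrite [RHS]mevalE /qscale raddf_sum /=; apply: eq_bigr => m _.
rewrite mevalZ mevalX -mulrA; congr (_ * _).
rewrite expr_sum big_mkcond -prodfV -big_split; apply: eq_bigr => i _.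
rewrite exprMn exprVn mulrC; congr (_ * _); congr (_^-1).
by case: ifP => _; rewrite ?expr1n ?expr1 ?expr0.
Qed.

Lemma mspec1_qscale k p g : mspec1 p g -> mspec1 (qscale k p) g.
Proof.
move=> h m; rewrite mcoeff_qscale -[g@_m]mulr1; apply: spec1M => //.
rewrite -invr1 -(expr1n _ (\sum_(i : 'I_n | (i < k)%N) m i)%N).
by apply: spec1V; [exact/spec1X/spec1_q|rewrite expr1n oner_eq0].
Qed.

(** The leading power of [q] restores coefficient 1 at [x^lam] after the scaling. *)
Definition raise k (kn : (k <= n)%N) lam p : {mpoly Kqt[n]} :=
  qK ^+ (\sum_(i : 'I_n | (i < k)%N) (lam i).-1)
    *: (linprod (front n k) (fun=> tK ^- n.-1) * qscale k (msym (rho kn) p)).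

Lemma mspec1_raise k (kn : (k <= n)%N) lam p g : mspec1 p g ->
  mspec1 (raise kn lam p) (linprod (front n k) (fun=> tQ ^- n.-1) * msym (rho kn) g).
Proof.
move=> pg; rewrite -[X in mspec1 _ X]scale1r.
rewrite -(expr1n _ (\sum_(i : 'I_n | (i < k)%N) (lam i).-1)).
apply: mspec1Z; first exact/spec1X/spec1_q.
apply: mspec1M; last exact/mspec1_qscale/mspec1_msym.
apply: mspec1_prod => i _; apply: mspec1B; first exact: mspec1_X.
by apply/mspec1_C/spec1V; [exact/spec1X/spec1_t|rewrite expf_neq0 ?tQ_neq0].
Qed.

Lemma interpolant_raise k (kn : (k <= n)%N) lam p :
  (forall i : 'I_n, (0 < lam i)%N = (i < k)%N) ->
  interpolant (lower kn lam) p -> interpolant lam (raise kn lam p).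
Proof.
move=> hl [dom tri van nz [g pg]].
have posl (i : 'I_n) : (i < k)%N -> (0 < lam i)%N by rewrite hl.
have q0 e : qK ^+ e != 0 by rewrite expf_neq0 ?qK_neq0.
have ck : conjp lam 1 = k.
  by rewrite -[RHS](card_front kn); apply: eq_card => i; rewrite !inE hl.
have mdl := lower_mdeg kn posl.
set f := qscale k (msym (rho kn) p).
have domf m : f@_m != 0 -> dominates (lower kn lam) m.
  rewrite mcoeff_qscale mulf_eq0 negb_or mcoeff_sym => /andP[/dom d _].
  have := dominates_mperm (rho kn)^-1%g d; congr dominates.
  by apply/mnmP=> j; rewrite !mnmE permKV.
have degf m : f@_m != 0 -> (mdeg m <= mdeg (lower kn lam))%N by move/domf/dominates_mdeg.
have evf nu : (forall i : 'I_n, (i < k)%N -> (0 < nu i)%N) ->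
    f.@[tilde nu] = p.@[tilde (lower kn nu)].
  move=> pos; rewrite /f meval_qscale meval_msym; apply: meval_eq => j /=.
  by rewrite tilde_lower.
split.
- move=> m; rewrite mcoeffZ mulf_eq0 negb_or => /andP[_ /linprod_supp[m' /domf d le]] I.
  apply: leq_trans (topsum_up #|I| (fun c => conjp_lower kn c hl) _); last by rewrite ck.
  have h : (\sum_(i in I) m i <= \sum_(i in I) (m' i + (i \in front n k)))%N.
    by apply: leq_sum => i _; exact: le.
  apply: leq_trans h _; rewrite big_split /=.
  apply: leq_add; first exact: d.
  rewrite ck leq_min; apply/andP; split.
    by rewrite -sum1_card; apply: leq_sum => i _; case: (_ \in _).
  rewrite -[leqRHS](card_front kn) -sum1_card big_mkcond [leqRHS]big_mkcond /=.
  by apply: leq_sum => i _; case: (i \in I); case: (i \in front n k).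
(* A rearrangement with nonzero coefficient is positive on the front, hence has the same support as
   [lam], and its coefficient comes from that of [p] at its lowering. *)
- have cf nu : rearr nu lam -> (raise kn lam p)@_nu != 0 ->
      (forall i : 'I_n, (i < k)%N -> (0 < nu i)%N) /\ p@_(lower kn nu) != 0.
    move=> pe; rewrite mcoeffZ (mcoeff_linprod _ degf); last first.
      by rewrite (mdeg_rearr pe) mdl card_front.
    case: ifP => [/forallP pos|_]; last by rewrite mulr0 eqxx.
    rewrite mulf_eq0 negb_or mcoeff_qscale mulf_eq0 negb_or mcoeff_sym -lowerE.
    move=> /andP[_ /andP[h _]]; split=> // i ik.
    by have := pos i; rewrite inE ik.
  split.
    rewrite mcoeffZ (mcoeff_linprod _ degf); last by rewrite mdl card_front.
    rewrite ifT; last by apply/forallP=> i; rewrite inE; apply/implyP/posl.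
    rewrite mcoeff_qscale mcoeff_sym -lowerE; have [-> _] := tri.
    have -> : (\sum_(i : 'I_n | (i < k)%N) (lam - oneS (front n k))%MM i
              = \sum_(i : 'I_n | (i < k)%N) (lam i).-1)%N.
      by apply: eq_bigr => i ik; rewrite mnmBE mnmE inE ik subn1.
    by rewrite mul1r; exact: mulfV (q0 _).
  move=> nu pe le_nu ne; apply/eqP; apply: contraT => /(cf _ pe)[pos].
  have hn := supp_rearr hl pe pos; have pe' := lower_rearr kn hn hl pe.
  have [_ ->] := tri; rewrite ?eqxx //.
    by rewrite !inv_lower // (conjp_rearr _ pe') leq_add2r.
  by apply: contra ne => /eqP/lower_inj->.
- move=> nu le_nu ne; rewrite mevalZ mevalM.
  case: (boolP [forall i : 'I_n, (i < k)%N ==> (0 < nu i)%N]) => [/forallP pos|].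
    have {}pos (i : 'I_n) : (i < k)%N -> (0 < nu i)%N by move/implyP: (pos i).
    rewrite (evf _ pos) van ?mulr0 //; first by move: le_nu; rewrite mdl (lower_mdeg kn pos); lia.
    by apply: contra ne => /eqP/lower_inj->.
  rewrite negb_forall => /existsP[i0 h0].
  (* The first zero part of [nu] lies in the front, and its coordinate [t^(1-n)] kills a linear
     factor. *)
  pose Q (i : 'I_n) := nu i == 0%N.
  have Q0 : Q i0 by move: h0; rewrite /Q; lia.
  case: (arg_minnP (fun i : 'I_n => i : nat) Q0) => i Qi mn.
  have ik : i \in front n k by rewrite inE; have := mn i0 Q0; move: h0; lia.
  have vi : tilde nu i = tK ^- n.-1.
    rewrite /tilde (kidx_zero (eqP Qi)); first by rewrite (eqP Qi) expr0 mul1r.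
    by move=> l li; rewrite lt0n; apply/negP => /mn; lia.
  by rewrite /linprod (bigD1 i ik) mevalM mevalB mevalXU mevalC vi subrr !mul0r mulr0.
- rewrite mevalZ mevalM (evf _ posl); apply: mulf_neq0; first exact: q0.
  apply: mulf_neq0; last exact: nz.
  rewrite /linprod rmorph_prod; apply/prodf_neq0 => i; rewrite inE => ik.
  rewrite -[X in X != 0]/(meval _ _) mevalB mevalXU mevalC subr_eq0 /tilde -[tK ^- n.-1]mul1r.
  rewrite eqr_div ?expf_neq0 ?tK_neq0 // -(expr0 qK).
  by apply/eqP => /qt_eq[h _]; have := posl _ ik; rewrite h.
- by exists (linprod (front n k) (fun=> tQ ^- n.-1) * msym (rho kn) g); exact: mspec1_raise.
Qed.

Lemma interpolant0 : interpolant 0%MM 1.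
Proof.
split.
- move=> m; rewrite mcoeff1; case: (eqVneq m 0%MM) => [->|]; last by rewrite eqxx.
  by move=> _ I; rewrite big1 // => i _; rewrite mnm0E.
- split; first by rewrite mcoeff1 eqxx.
  by move=> nu _ _ ne; rewrite mcoeff1 (negPf ne).
- move=> nu; rewrite mdeg0 leqn0 mdeg_eq0 => /eqP->; by rewrite eqxx.
- by rewrite meval1 oner_eq0.
- by exists 1; exact: mspec1_1.
Qed.

Lemma partition_supp lam : is_partition lam ->
  forall i : 'I_n, (0 < lam i)%N = (i < conjp lam 1)%N.
Proof.
move/partitionP=> h i; rewrite /conjp; apply/idP/idP => hi.
  have le_in := ltn_ord i; rewrite -[X in (X <= _)%N](card_front le_in).
  apply: subset_leq_card; apply/subsetP=> j; rewrite !inE ltnS => /h; lia.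
apply: contraLR hi; rewrite -leqNgt leqn0 -leqNgt => /eqP z.
rewrite -[leqRHS](card_front (ltnW (ltn_ord i))).
apply: subset_leq_card; apply/subsetP=> j; rewrite !inE => pj.
by rewrite ltnNge; apply/negP => /h; lia.
Qed.

Lemma conjp_le lam c : (conjp lam c <= n)%N.
Proof. by rewrite -[leqRHS]card_ord; exact: max_card. Qed.

(** Outer induction on the degree, inner induction by sorting: a nonzero partition is raised from a
    composition of smaller degree, and the rest of its class is reached by swaps. *)
Theorem interpolant_ex mu : exists p, interpolant mu p.
Proof.
have [N] := ubnP (mdeg mu); elim: N mu => // N IH mu; move: mu.
apply: sort_ind => [lam pl lt_N|mu i lt_i IHmu]; last first.
  rewrite mdeg_swm => /IHmu[p hp]; exists (hki tK i p - hk_coef (tilde mu) i *: p).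
  exact: interpolant_sw.
have hl := partition_supp pl; have kn := conjp_le lam 1.
have mdl : mdeg lam = (mdeg (lower kn lam) + conjp lam 1)%N.
  by apply: lower_mdeg => i; rewrite hl.
case: (posnP (conjp lam 1)) => k0; last first.
  have [|p hp] := IH (lower kn lam); first by lia.
  by exists (raise kn lam p); apply: interpolant_raise.
have -> : lam = 0%MM by apply/mnmP=> i; rewrite mnm0E; have := hl i; rewrite k0; lia.
by exists 1; exact: interpolant0.
Qed.

(** * Interpolation at the nodes: existence and uniqueness *)

Lemma interpolation_onto d (v : 'X_{1..n} -> Kqt) :
  exists2 f : {mpoly Kqt[n]}, (msize f <= d.+1)%N &
    forall nu, (mdeg nu <= d)%N -> f.@[tilde nu] = v nu.
Proof.
have step e (f : {mpoly Kqt[n]}) : (msize f <= e.+1)%N ->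
    (forall nu, (mdeg nu < e)%N -> f.@[tilde nu] = v nu) ->
    exists2 f' : {mpoly Kqt[n]}, (msize f' <= e.+1)%N &
    forall nu, (mdeg nu <= e)%N -> f'.@[tilde nu] = v nu.
  (* Newton interpolation: the interpolants of degree [e] correct the values in degree [e] one at a
     time without disturbing lower degrees. *)
  move=> sf hf; pose E mu := sval (constructive_indefinite_description _ (interpolant_ex mu)).
  have hE mu : interpolant mu (E mu) by rewrite /E; case: constructive_indefinite_description.
  pose c nu := (v nu - f.@[tilde nu]) / (E nu).@[tilde nu].
  exists (f + \sum_(mu : 'X_{1..n < e.+1} | mdeg mu == e) c mu *: E mu).
    apply: leq_trans (mmeasureD_le _ _ _) _; rewrite geq_max sf /=.
    apply: leq_trans (mmeasure_sum _ _ _ _) _; apply/bigmax_leqP => mu /eqP me.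
    apply: leq_trans (msizeZ_le _ _) _; have [/dominated_msize] := hE mu.
    by rewrite me.
  move=> nu; rewrite leq_eqVlt mevalD raddf_sum /= => /orP[/eqP ne|lt_nu].
    have lt_nu : (mdeg nu < e.+1)%N by rewrite ne.
    rewrite (bigD1 (BMultinom lt_nu)) /=; last exact/eqP.
    rewrite big1 ?addr0 => [|mu /andP[/eqP me nm]].
      have [_ _ _ nz _] := hE nu; by rewrite mevalZ /c divfK // addrC subrK.
    have [_ _ van _ _] := hE mu; rewrite mevalZ van ?mulr0 //; first by rewrite ne me.
    by apply: contraNneq nm => e'; apply/eqP/val_inj.
  rewrite big1 ?addr0 ?hf // => mu /eqP me; have [_ _ van _ _] := hE mu.
  rewrite mevalZ van ?mulr0 //; first by rewrite me ltnW.
  by apply: contraTneq lt_nu => ->; rewrite me ltnn.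
elim: d => [|d [f sf hf]]; last first.
  by apply: (step d.+1 f) => //; apply: leq_trans sf _.
by apply: (step 0%N 0) => //; rewrite msize0.
Qed.

Lemma interpolation_inj d (f : {mpoly Kqt[n]}) : (msize f <= d.+1)%N ->
  (forall nu, (mdeg nu <= d)%N -> f.@[tilde nu] = 0) -> f = 0.
Proof.
move=> sf hf; pose T := 'X_{1..n < d.+1}.
(* Nodes and monomials up to degree [d] share an index set, so evaluation is a square matrix;
   surjectivity makes it invertible, hence injective. *)
pose A := \matrix_(r < #|{: T}|, s < #|{: T}|)
   \prod_(i < n) tilde (enum_val s : T) i ^+ (enum_val r : T) i.
have row (g : {mpoly Kqt[n]}) : (msize g <= d.+1)%N ->
   (\row_r g@_(enum_val r : T)) *m A = \row_s g.@[tilde (enum_val s : T)].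
  move=> sg; apply/rowP=> s; rewrite !mxE {2}(mpolywE sg) raddf_sum /=.
  rewrite (big_enum_val (fun m : T => meval _ (g@_m *: 'X_[m]))) /=.
  by apply: eq_bigr => r _; rewrite !mxE mevalZ mevalX.
have pick s : exists u : 'rV[Kqt]_#|{: T}|, u *m A = delta_mx 0 s.
  have [g sg hg] := interpolation_onto d (fun nu => (nu == (enum_val s : T))%:R).
  exists (\row_r g@_(enum_val r : T)); rewrite row //; apply/rowP=> s'.
  rewrite !mxE hg; last by rewrite -ltnS bmdeg.
  rewrite eqxx /=; congr (_ : bool)%:R; apply/eqP/eqP => [/val_inj/enum_val_inj//|->//].
have uA : A \in unitmx.
  pose B := \matrix_(s < #|{: T}|) sval (constructive_indefinite_description _ (pick s)).
  have BA : B *m A = 1%:M.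
    apply/row_matrixP=> s; rewrite row_mul rowK row1.
    by case: constructive_indefinite_description.
  by have [] := mulmx1_unit BA.
have z : \row_r f@_(enum_val r : T) = 0 :> 'rV[Kqt]_#|{: T}|.
  apply: (can_inj (mulmxK uA)); rewrite mul0mx row //; apply/rowP=> s.
  by rewrite !mxE hf // -ltnS bmdeg.
apply/mpolyP=> m; rewrite mcoeff0; case: (ltnP (mdeg m) d.+1) => lt_m.
  have /rowP/(_ (enum_rank (BMultinom lt_m : T))) := z.
  by rewrite !mxE enum_rankK.
by apply/memN_msupp_eq0/msize_mdeg_ge; apply: leq_trans sf lt_m.
Qed.

(* Two polynomials with a common vanishing locus are proportional, hence equal once one
   coefficient is normalised. *)
Lemma interpolation_uniq d mu (f g : {mpoly Kqt[n]}) m :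
  (msize f <= d.+1)%N -> (msize g <= d.+1)%N -> f@_m = 1 -> g@_m = 1 ->
  (forall nu, (mdeg nu <= d)%N -> (f.@[tilde nu] = 0 /\ g.@[tilde nu] = 0) \/
     (f.@[tilde nu] = f.@[tilde mu] /\ g.@[tilde nu] = g.@[tilde mu])) ->
  f = g.
Proof.
move=> sf sg f1 g1 h.
have comb c c' : (msize (c *: f - c' *: g) <= d.+1)%N.
  apply: leq_trans (mmeasureD_le _ _ _) _; rewrite geq_max mmeasureN.
  by rewrite !(leq_trans (msizeZ_le _ _)).
have e0 : g.@[tilde mu] *: f - f.@[tilde mu] *: g = 0.
  apply: (interpolation_inj (comb _ _)) => nu le_nu; rewrite mevalB !mevalZ.
  have [[-> ->]|[-> ->]] := h nu le_nu; first by rewrite !mulr0 subrr.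
  by rewrite mulrC subrr.
have e1 : f.@[tilde mu] = g.@[tilde mu].
  have := congr1 (mcoeff m) e0; rewrite mcoeffB !mcoeffZ mcoeff0 f1 g1 !mulr1.
  by move/eqP; rewrite subr_eq0 => /eqP.
apply/eqP; rewrite -subr_eq0; apply/eqP.
have := comb 1 1; rewrite !scale1r => sfg; apply: (interpolation_inj sfg) => nu le_nu.
by rewrite mevalB; have [[-> ->]|[-> ->]] := h nu le_nu; rewrite ?e1 subrr.
Qed.

Lemma IsEstar_uniq mu p p' : IsEstar mu p -> IsEstar mu p' -> p = p'.
Proof.
move=> [s1 c1 v1] [s2 c2 v2]; apply: (@interpolation_uniq (mdeg mu) mu _ _ mu) => //.
move=> nu le_nu; case: (eqVneq nu mu) => [->|ne]; first by right.
by left; split; [exact: v1|exact: v2].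
Qed.

Lemma interpolant_IsEstar mu p : interpolant mu p -> IsEstar mu p.
Proof. by case=> d [e _] v _ _; split=> //; exact: dominated_msize. Qed.

Lemma EstarE mu p : IsEstar mu p -> Estar mu = p.
Proof.
move=> h; apply: (IsEstar_uniq (mu := mu)) => //.
by apply: (epsilon_spec (inhabits 0) (IsEstar mu)); exists p.
Qed.

Lemma Estar_interpolant mu : interpolant mu (Estar mu).
Proof.
have [p hp] := interpolant_ex mu.
by rewrite (EstarE (interpolant_IsEstar hp)).
Qed.

Lemma hki_Estar_desc mu i : (mu (hi_ix i) < mu (lo_ix i))%N ->
  hki tK i (Estar mu) = Estar (swi i mu) + hk_coef (tilde mu) i *: Estar mu.
Proof.
move=> lt_i; have := interpolant_sw lt_i (Estar_interpolant mu).
by move/interpolant_IsEstar/EstarE=> ->; rewrite subrK.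
Qed.

(** The difference of the two sides vanishes at every node up to the degree of [mu], the node of
    [mu] included. *)
Lemma hki_Estar_flat mu i : mu (lo_ix i) = mu (hi_ix i) ->
  hki tK i (Estar mu) = tK *: Estar mu.
Proof.
move=> fl; have [dom _ van _ _] := Estar_interpolant mu; apply/eqP; rewrite -subr_eq0.
apply/eqP; apply: (@interpolation_inj (mdeg mu)).
  apply/dominated_msize/dominatedBZ; last exact: dom.
  exact/dominated_hk/dom/lo_hi_neq.
move=> nu le_nu; rewrite mevalB mevalZ.
case: (eqVneq (nu (lo_ix i)) (nu (hi_ix i))) => [e|ne].
  by rewrite meval_hki_flat // subrr.
rewrite (meval_hki _ ne).
have -> : (Estar mu).@[tilde nu] = 0.
  by apply: van => //; apply: contraNneq ne => ->; rewrite fl.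
have -> : (Estar mu).@[tilde (swi i nu)] = 0.
  apply: van; first by rewrite mdeg_swm.
  by apply: contraNneq ne => e; move: fl; rewrite -e swmL swmR => ->.
by rewrite !mulr0 addr0 subr0.
Qed.

Lemma Estar_raise k (kn : (k <= n)%N) lam :
  (forall i : 'I_n, (0 < lam i)%N = (i < k)%N) ->
  Estar lam = raise kn lam (Estar (lower kn lam)).
Proof.
move=> hl; apply/EstarE/interpolant_IsEstar/interpolant_raise => //.
exact: Estar_interpolant.
Qed.

End Interpolation.

(** * The interpolation polynomials at q = 1 *)

Lemma symmetric_sadj (K : fieldType) n (f : {mpoly K[n]}) :
  (forall i : 'I_n.-1, msym (sadj i) f = f) -> f \is symmetric.
Proof.
move=> h; apply/issymP=> s; have [<- _] := red_wordP s.
by elim: (red_word s) => [|i w IH] /=; rewrite ?msym1m // msymMm IH h.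
Qed.

(** Moves a linear factor from [a] to [b] and multiplies its constant by [t], matching the change of
    exponent in [Sfactor]. *)
Lemma hk_linear_factor (K : fieldType) n (t c : K) (a b : 'I_n) (f : {mpoly K[n]}) :
  a != b -> msym (tperm a b) f = f ->
  hk t a b (('X_a - c%:MP) * f) = ('X_b - (t * c)%:MP) * f.
Proof.
move=> ab sf; rewrite hk_mulsym //; congr (_ * _); apply: hkP => //.
rewrite msymB /msym mmapX mmap1U mmapC tpermL mpolyCM !mpolyCD !mpolyCN mpolyC1.
ring.
Qed.

(** The value of [hk_coef1] when the two ranks differ by exactly one. *)
Lemma ascent_coef_limit (K : fieldType) (t : K) k : t != 0 -> t - 1 != 0 ->
  (1 - t) * t ^- k.+1 / (t ^- k - t ^- k.+1) = -1.
Proof.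
move=> t0 t1; have tk : t ^+ k != 0 by rewrite expf_neq0.
have -> : t ^- k - t ^- k.+1 = (t - 1) * t ^- k.+1.
  by rewrite exprS; field; rewrite tk t0.
rewrite -mulf_div mulfV ?invr_eq0 ?expf_neq0 // mulr1 -(opprB t 1) mulNr.
by rewrite mulfV.
Qed.

Lemma ascent_collapse (K : fieldType) (V : lmodType K) (t : K) (x y : V) :
  (t - 1 - -1) *: x + (t + -1 * (t - 1 - -1)) *: y = t *: x.
Proof.
rewrite (_ : t - 1 - -1 = t); last by ring.
by rewrite mulN1r subrr scale0r addr0.
Qed.

Section AtOne.

Variable n : nat.
Implicit Types (lam mu nu : 'X_{1..n}) (S : {set 'I_n}).

Definition E1 mu : {mpoly Kt[n]} :=
  epsilon (inhabits 0) (fun g => mspec1 (Estar mu) g).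

Lemma E1P mu : mspec1 (Estar mu) (E1 mu).
Proof.
have [_ _ _ _ h] := Estar_interpolant mu.
exact: (epsilon_spec (inhabits 0) (fun g => mspec1 (Estar mu) g) h).
Qed.

Lemma E1E mu g : mspec1 (Estar mu) g -> E1 mu = g.
Proof. exact/mspec1_uniq/E1P. Qed.

Lemma E1_dominated mu : dominated mu (E1 mu).
Proof.
have [d _ _ _ _] := Estar_interpolant mu => m ne; apply: d.
apply: contraNneq ne => e; apply/eqP.
by have := E1P mu m; rewrite e => h; exact: spec1_uniq h spec1_0.
Qed.

Lemma E1_unitri mu : unitri mu (E1 mu).
Proof.
have [_ [e1 e0] _ _ _] := Estar_interpolant mu; split=> [|nu pe le ne].
  by have := E1P mu mu; rewrite e1 => h; exact: spec1_uniq h spec1_1.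
by have := E1P mu nu; rewrite e0 // => h; exact: spec1_uniq h spec1_0.
Qed.

Lemma E1_descent mu (i : 'I_n.-1) : (mu (hi_ix i) < mu (lo_ix i))%N ->
  hki tQ i (E1 mu) = E1 (swi i mu) + hk_coef1 mu i *: E1 mu.
Proof.
move=> lt_i; have := mspec1_hk (lo_hi_neq i) (E1P mu).
rewrite -/(hki tK i _) -/(hki tQ i _) (hki_Estar_desc lt_i) => h.
apply: mspec1_uniq h _; apply: mspec1D; first exact: E1P.
by apply: mspec1Z; [exact: spec1_hk_coef|exact: E1P].
Qed.

Lemma E1_flat mu (i : 'I_n.-1) : mu (lo_ix i) = mu (hi_ix i) ->
  hki tQ i (E1 mu) = tQ *: E1 mu.
Proof.
move=> fl; have := mspec1_hk (lo_hi_neq i) (E1P mu).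
rewrite -/(hki tK i _) -/(hki tQ i _) (hki_Estar_flat fl) => h.
by apply: mspec1_uniq h _; apply: mspec1Z; [exact: spec1_t|exact: E1P].
Qed.

Lemma E1_descent_ex mu (i : 'I_n.-1) : (mu (hi_ix i) < mu (lo_ix i))%N ->
  exists c, hki tQ i (E1 mu) = E1 (swi i mu) + c *: E1 mu.
Proof. by move=> h; exists (hk_coef1 mu i); exact: E1_descent. Qed.

Lemma E1_raise k (kn : (k <= n)%N) lam :
  (forall i : 'I_n, (0 < lam i)%N = (i < k)%N) ->
  E1 lam = linprod (front n k) (fun=> tQ ^- n.-1) * msym (rho kn) (E1 (lower kn lam)).
Proof.
move=> hl; apply: E1E; rewrite (Estar_raise kn hl).
exact/mspec1_raise/E1P.
Qed.

Lemma tQB1_neq0 : tQ - 1 != 0.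
Proof.
by rewrite subr_eq0; apply/eqP => h; have := @tQ_expI 1 0; rewrite /= expr1 expr0 => /(_ h).
Qed.

Definition increasing mu := forall i j : 'I_n, (i <= j)%N -> (mu i <= mu j)%N.

(* At q = 1 the intertwining relation at an ascent of minimal rank gap degenerates to
   T_i E = t E. *)
Lemma E1_increasing_fix mu (i : 'I_n.-1) : increasing mu ->
  hki tQ i (E1 mu) = tQ *: E1 mu.
Proof.
move=> inc; have := inc (lo_ix i) (hi_ix i); rewrite hi_ixE leqnSn => /(_ isT).
rewrite leq_eqVlt => /orP[/eqP/E1_flat//|lt_i].
have ks : swi i (swi i mu) = mu by exact: swmK.
have lt_s : (swi i mu (hi_ix i) < swi i mu (lo_ix i))%N by rewrite swmL swmR.
have := E1_descent lt_s; move/hk_E_ascent; rewrite ks => ->.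
have bE l j : beats mu l j = (j < l)%N.
  rewrite /beats; case: (ltngtP j l) => h.
  - by have := inc j l (ltnW h); lia.
  - by have := inc l j (ltnW h); lia.
  - by rewrite (ord_inj h); lia.
have kE : kidx mu (lo_ix i) = (kidx mu (hi_ix i)).+1.
  apply: kidx_adj (hi_ixE i) _ _; last by rewrite bE hi_ixE.
  move=> l lb; rewrite !bE; have {lb} : (l : nat) != hi_ix i by [].
  by rewrite hi_ixE; lia.
have -> : hk_coef1 (swi i mu) i = -1; last exact: ascent_collapse.
rewrite /hk_coef1 !kidx_swm ?hi_ixE ?neq_ltn ?lt_i // tpermL tpermR kE.
exact: ascent_coef_limit tQ_neq0 tQB1_neq0.
Qed.

Lemma E1_increasing_sym mu : increasing mu -> E1 mu \is symmetric.
Proof.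
move=> inc; apply: symmetric_sadj => i.
exact: hk_fix (lo_hi_neq i) tQ_neq0 (E1_increasing_fix i inc).
Qed.

(** Symmetry spreads the leading coefficient over the whole class. *)
Lemma E1_increasing_coef mu nu : increasing mu -> rearr nu mu -> (E1 mu)@_nu = 1.
Proof.
move=> inc /rearrP[s ->]; rewrite msym_coeff; last exact: E1_increasing_sym.
by have [] := E1_unitri mu.
Qed.

(** * Removal of the first column and the factors of subsets *)

Definition revp : 'S_n := perm (@rev_ord_inj n).

Definition revm lam : 'X_{1..n} := [multinom lam (revp j) | j < n].

Lemma revm_rearr lam : rearr (revm lam) lam.
Proof. by apply/rearrP; exists revp. Qed.

Lemma revm_increasing lam : is_partition lam -> increasing (revm lam).
Proof.
by move/partitionP=> h i j le_ij; rewrite !mnmE !permE; apply: h => /=; lia.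
Qed.

Definition predm lam : 'X_{1..n} := [multinom (lam i).-1 | i < n].

Lemma predm_partition lam : is_partition lam -> is_partition (predm lam).
Proof. by move/partitionP=> h; apply/partitionP=> i j /h; rewrite !mnmE; lia. Qed.

Lemma predm_rearr nu lam : rearr nu lam -> rearr (predm nu) (predm lam).
Proof.
by case/rearrP=> s ->; apply/rearrP; exists s; apply/mnmP=> j; rewrite !mnmE.
Qed.

Lemma predm_mdeg lam : mdeg lam = (mdeg (predm lam) + conjp lam 1)%N.
Proof.
rewrite /conjp -mdeg_oneS -mdegD; congr mdeg; apply/mnmP=> i.
by rewrite mnmDE !mnmE inE; lia.
Qed.

Lemma conjp_predm lam c : conjp (predm lam) c.+1 = conjp lam c.+2.
Proof. by apply: eq_card => j; rewrite !inE mnmE; lia. Qed.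

Lemma card_supp_rearr nu lam : rearr nu lam -> #|supp nu| = conjp lam 1.
Proof. by move=> pe; rewrite -(conjp_rearr 1 pe). Qed.

(** In top degree a nonzero coefficient forces [S] into the support of [nu], hence equality by
    cardinality; removing one unit from each positive part then gives a rearrangement of
    [predm lam]. *)
Lemma Sfactor_coef lam S (A : {mpoly Kt[n]}) nu :
  #|S| = conjp lam 1 -> rearr nu lam ->
  (forall m, A@_m != 0 -> (mdeg m <= mdeg (predm lam))%N) ->
  (forall m, rearr m (predm lam) -> A@_m = 1) ->
  (Sfactor S * A)@_nu = (supp nu == S)%:R.
Proof.
move=> cS pe degA A1; rewrite /Sfactor -/(linprod S _) (mcoeff_linprod _ degA); last first.
  by rewrite (mdeg_rearr pe) cS -predm_mdeg.
case: (eqVneq (supp nu) S) => [<-|ne].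
  rewrite ifT; last by apply/forallP=> i; rewrite inE implybb.
  apply: A1; rewrite (_ : (_ - _)%MM = predm nu); first exact: predm_rearr.
  by apply/mnmP=> i; rewrite mnmBE !mnmE inE; lia.
rewrite ifF //; apply: contraNF ne => /forallP h; rewrite eq_sym eqEcard.
rewrite cS (card_supp_rearr pe) leqnn andbT; apply/subsetP=> i iS.
by have := h i; rewrite iS inE.
Qed.

Lemma hki_Sfactor S (i : 'I_n.-1) (A : {mpoly Kt[n]}) : lo_ix i \in S -> hi_ix i \notin S ->
  A \is symmetric ->
  hki tQ i (Sfactor S * A) = Sfactor (hi_ix i |: S :\ lo_ix i) * A.
Proof.
move=> loS hiS symA; set a := lo_ix i in loS *; set b := hi_ix i in hiS *.
have ab : a != b := lo_hi_neq i; have bE : b = a.+1 :> nat := hi_ixE i.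
set S' := b |: S :\ a.
pose c (T : {set 'I_n}) (l : 'I_n) : Kt := tQ ^+ #|[set j in ~: T | (j < l)%N]| / tQ ^+ n.-1.
pose R := linprod (S :\ a) (c S).
have e1 : Sfactor S = ('X_a - (c S a)%:MP) * R by rewrite /Sfactor (big_setD1 a loS).
have bS : b \notin S :\ a by rewrite !inE negb_and hiS orbT.
have e2 : Sfactor S' = ('X_b - (tQ * c S a)%:MP) * R.
  rewrite /Sfactor big_setU1 //=; congr (('X_b - _%:MP) * _).
    rewrite /c mulrA -exprS; congr (_ ^+ _ / _).
    (* Moving [a] to [b] puts one more complement element, [a] itself, to the left of the moved
       point: this is the factor [t]. *)
    have -> : [set j in ~: S' | (j < b)%N] = a |: [set j in ~: S | (j < a)%N].
      apply/setP=> j; rewrite !inE; case: (eqVneq j a) => [->|ja].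
        by rewrite (negPf ab) /= bE ltnSn.
      case: (eqVneq j b) => [->|jb] /=; first by rewrite bE ltnNge leqnSn andbF.
      by rewrite bE ltnS leq_eqVlt -[X in X || _]/(j == a) (negPf ja).
    by rewrite cardsU1 !inE ltnn andbF.
  apply: eq_bigr => l; rewrite !inE => /andP[la lS].
  have lb : l != b by apply: contraNneq hiS => <-.
  congr ('X_l - (_ ^+ _ / _)%:MP).
  (* Any other [l] lies on the same side of [a] and [b], so the swap matches the complement elements
     to its left. *)
  have abl : (a < l)%N = (b < l)%N.
    by rewrite [RHS]ltn_neqAle -[X in ~~ X]/(b == l) eq_sym lb bE.
  rewrite -[RHS](card_imset _ (@perm_inj _ (tperm a b))); apply: eq_card => j.
  rewrite (can_imset_pre _ (@tpermK _ a b)) !inE.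
  case: (tpermP a b j) => [->|->|/eqP ja /eqP jb].
  - by rewrite eqxx (negPf ab) hiS /= abl.
  - by rewrite eqxx loS.
  - by rewrite (negPf ja) (negPf jb).
rewrite e1 e2 -!mulrA /hki -/a -/b; apply: hk_linear_factor => //.
rewrite msymM; move/issymP: symA => ->; congr (_ * _).
rewrite /R /linprod rmorph_prod /=; apply: eq_bigr => l; rewrite !inE => /andP[la lS].
have lb : l != b by apply: contraNneq hiS => <-.
by rewrite -[LHS]/(msym (tperm a b) _) msymB /msym mmapX mmap1U mmapC tpermD // eq_sym.
Qed.

Let U := inU E1.

Lemma Sfactor_inU lam S : is_partition lam -> #|S| = conjp lam 1 ->
  U lam (Sfactor S * E1 (revm (predm lam))).
Proof.
move=> pl; set A := E1 _.
have pp := predm_partition pl; have inc := revm_increasing pp.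
have symA : A \is symmetric := E1_increasing_sym inc.
have base : U lam (Sfactor (front n (conjp lam 1)) * A).
  have kn := conjp_le lam 1; set k := conjp lam 1 in kn *; pose r := rho kn.
  (* The nonzero parts of [lam] in increasing order, followed by zeros: lowering this composition
     gives the increasing rearrangement of [predm lam]. *)
  pose kap : 'X_{1..n} := [multinom lam (revp ((r^-1)%g i)) | i < n].
  have pe : rearr kap lam.
    by apply/rearrP; exists (r^-1 * revp)%g; apply/mnmP=> i; rewrite !mnmE permM.
  have hk' (i : 'I_n) : (0 < kap i)%N = (i < k)%N.
    rewrite mnmE (partition_supp pl) -/k -{2}(permKV r i) rho_lt permE /=.
    by have := ltn_ord ((r^-1)%g i); lia.
  have dk : lower kn kap = revm (predm lam).
    apply/mnmP=> j; rewrite !mnmE permK -[X in (_ - X)%N]/(nat_of_bool (r j < k)%N).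
    by rewrite -hk' mnmE permK; lia.
  have eA : E1 kap = Sfactor (front n k) * A.
    rewrite (E1_raise kn hk') dk -/A; move/issymP: symA => ->; congr (_ * _).
    apply: eq_bigr => i; rewrite inE => ik; congr ('X_i - _%:MP).
    rewrite (_ : [set j in _ | _] = set0); first by rewrite cards0 expr0 mul1r.
    by apply/setP=> j; rewrite !inE; lia.
  by rewrite -eA; exact: inU_E pe.
(* Subsets are viewed as 0-1 compositions, so that [sort_ind] moves from the front set to an
   arbitrary one. *)
suff H mu : forall T : {set 'I_n}, mu = oneS T -> #|T| = conjp lam 1 ->
    U lam (Sfactor T * A) by move=> cS; apply: H erefl cS.
elim/sort_ind: mu => [mu pm T e cT|mu i lt_i IH T e cT].
  rewrite (_ : T = front n (conjp lam 1)) //; apply/setP=> j; rewrite inE -cT.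
  have := partition_supp pm j; rewrite e mnmE lt0b => ->; congr (j < _)%N.
  by apply: eq_card => l; rewrite !inE mnmE lt0b.
pose s := tperm (lo_ix i) (hi_ix i); pose T' := [set j | s j \in T].
have e' : mu = oneS T'.
  by rewrite -(swmK (lo_ix i) (hi_ix i) mu) e; apply/mnmP=> j; rewrite !mnmE inE.
have TE : T = hi_ix i |: T' :\ lo_ix i.
  move: lt_i; rewrite e' !mnmE !inE /s tpermL tpermR => lt_i.
  apply/setP=> j; rewrite !inE; case: (eqVneq j (hi_ix i)) => [->|jb] /=.
    by move: lt_i; case: (hi_ix i \in T); case: (lo_ix i \in T).
  case: (eqVneq j (lo_ix i)) => [->|ja] /=.
    by move: lt_i; case: (hi_ix i \in T); case: (lo_ix i \in T).
  by rewrite tpermD // eq_sym.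
have [loT hiT] : lo_ix i \in T' /\ hi_ix i \notin T'.
  move: lt_i; rewrite e' !mnmE.
  by case: (lo_ix i \in T'); case: (hi_ix i \in T').
rewrite TE -(hki_Sfactor loT hiT symA).
apply: (inU_hk E1_descent_ex E1_flat); apply: IH => //.
rewrite -cT -(card_imset T' (@perm_inj _ s)); apply: eq_card => j.
by rewrite (can_imset_pre _ (@tpermK _ _ _)) !inE tpermK.
Qed.

Lemma E1_predm_deg lam : is_partition lam -> forall m,
  (E1 (revm (predm lam)))@_m != 0 -> (mdeg m <= mdeg (predm lam))%N.
Proof.
by move=> pl m /E1_dominated/dominates_mdeg; rewrite (mdeg_rearr (revm_rearr _)).
Qed.

Lemma E1_predm_coef lam : is_partition lam -> forall m, rearr m (predm lam) ->
  (E1 (revm (predm lam)))@_m = 1.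
Proof.
move=> pl m pe; apply: E1_increasing_coef; first exact/revm_increasing/predm_partition.
by apply: rearr_trans pe _; rewrite rearr_sym revm_rearr.
Qed.

(** Both sides lie in the span and have coefficient 1 at every rearrangement of [lam]: on the right
    exactly one [S], the support, contributes. *)
Lemma E1_rev_rec lam : is_partition lam ->
  E1 (revm lam) = estar n (conjp lam 1) * E1 (revm (predm lam)).
Proof.
move=> pl; apply: (inU_eq E1_unitri (lam := lam)).
- exact/inU_E/revm_rearr.
- rewrite /estar mulr_suml; apply: inU_sum => S /eqP cS; exact: Sfactor_inU.
move=> nu pe; rewrite E1_increasing_coef; last 2 first.
- exact: revm_increasing.
- by apply: rearr_trans pe _; rewrite rearr_sym revm_rearr.
rewrite /estar mulr_suml raddf_sum /=.
rewrite (eq_bigr (fun S => (supp nu == S)%:R)); last first.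
  move=> S /eqP cS; apply: (Sfactor_coef cS pe).
    exact: E1_predm_deg.
  exact: E1_predm_coef.
rewrite (bigD1 (supp nu)) /=; last by rewrite (card_supp_rearr pe).
by rewrite eqxx big1 ?addr0 // => S /andP[_]; rewrite eq_sym => /negPf->.
Qed.

Lemma E1_0 : E1 0%MM = 1.
Proof.
apply: E1E; rewrite (EstarE (interpolant_IsEstar (interpolant0 n))).
exact: mspec1_1.
Qed.

Lemma revm0 : revm 0%MM = 0%MM.
Proof. by apply/mnmP=> j; rewrite !mnmE. Qed.

Lemma part1_predm lam : part1 (predm lam) = (part1 lam).-1.
Proof.
rewrite /part1; case: (posnP n) => [n0|n_gt0].
  by rewrite !nth_default // size_tuple n0.
by rewrite -!(mnm_nth 0%N _ (Ordinal n_gt0)) mnmE.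
Qed.

Lemma part1_eq0 lam : is_partition lam -> part1 lam = 0%N -> lam = 0%MM.
Proof.
move/partitionP=> h e; apply/mnmP=> i; rewrite mnm0E.
have n_gt0 : (0 < n)%N by apply: leq_ltn_trans (ltn_ord i).
have := h (Ordinal n_gt0) i; rewrite (mnm_nth 0%N lam (Ordinal n_gt0)) /=.
by rewrite -/(part1 lam) e leqn0 => /(_ isT)/eqP.
Qed.

Lemma E1_rev_prod lam : is_partition lam ->
  E1 (revm lam) = \prod_(1 <= i < (part1 lam).+1) estar n (conjp lam i).
Proof.
move eN : (part1 lam) => N; elim: N lam eN => [|N IH] lam eN pl.
  by rewrite (part1_eq0 pl eN) revm0 E1_0 big_geq.
rewrite (E1_rev_rec pl) IH ?part1_predm ?eN //; last exact: predm_partition.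
rewrite [RHS]big_nat_recl //; congr (_ * _); rewrite big_nat_cond [RHS]big_nat_cond.
by apply: eq_bigr => -[|i] //= _; rewrite conjp_predm.
Qed.

Lemma E1_predm_prod lam : is_partition lam ->
  E1 (revm (predm lam)) = \prod_(2 <= i < (part1 lam).+1) estar n (conjp lam i).
Proof.
move=> pl; rewrite (E1_rev_prod (predm_partition pl)) part1_predm [RHS]big_add1 /=.
case: (part1 lam) => [|N]; first by rewrite !big_geq.
rewrite big_nat_cond [RHS]big_nat_cond.
by apply: eq_bigr => -[|i] //= _; rewrite conjp_predm.
Qed.

(** * Sums of Hecke images and the symmetric interpolation polynomials *)

Definition sigma_word lam mu := red_word (sigma_of lam mu).

Lemma fstarE lam mu : fstar lam mu = fword tK (@Estar n) lam (sigma_word lam mu).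
Proof.
rewrite /fstar /Tperm /fword /sigma_word; elim: (red_word _) => //= i w ->.
by rewrite HeckeE.
Qed.

Lemma mspec1_fstar lam mu : mspec1 (fstar lam mu) (fword tQ E1 lam (sigma_word lam mu)).
Proof.
rewrite fstarE /fword; elim: (sigma_word lam mu) => [|i w IH] /=; first exact: E1P.
exact: mspec1_hk (lo_hi_neq i) IH.
Qed.

(** At [q = 1] both sides lie in the span, with coefficient at [nu] the indicator of
    [supp nu = S]. *)
Lemma sum_fstar_supp lam S : is_partition lam -> #|S| = plen lam ->
  mspec1 (\sum_(mu : 'X_{1..n < (mdeg lam).+1} | rearr mu lam && (supp mu == S)) fstar lam mu)
    (Sfactor S * \prod_(2 <= i < (part1 lam).+1) estar n (conjp lam i)).
Proof.
move=> pl cS; rewrite -(E1_predm_prod pl).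
have [hU hc] := sum_fword E1_dominated E1_unitri E1_descent_ex E1_flat
  (fun mu => supp mu == S) pl (fun mu => red_word_sigma pl).
rewrite -(inU_eq E1_unitri hU (Sfactor_inU pl cS)).
  by apply: mspec1_sum => mu _; exact: mspec1_fstar.
move=> nu pe; rewrite hc //; apply/esym; apply: (Sfactor_coef cS pe).
  exact: E1_predm_deg.
exact: E1_predm_coef.
Qed.

Lemma Estar_dominated mu : dominated mu (Estar mu).
Proof. by have [] := Estar_interpolant mu. Qed.

Lemma Estar_unitri mu : unitri mu (Estar mu).
Proof. by have [] := Estar_interpolant mu. Qed.

Lemma Estar_descent mu (i : 'I_n.-1) : (mu (hi_ix i) < mu (lo_ix i))%N ->
  exists c, hki tK i (Estar mu) = Estar (swi i mu) + c *: Estar mu.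
Proof. by move=> h; exists (hk_coef (tilde mu) i); exact: hki_Estar_desc. Qed.

Lemma inU_vanish lam p nu : inU (@Estar n) lam p -> (mdeg nu <= mdeg lam)%N ->
  ~~ rearr nu lam -> p.@[tilde nu] = 0.
Proof.
case=> c -> le_nu np; rewrite raddf_sum /= big1 // => mu pe; rewrite mevalZ.
have [_ _ van _ _] := Estar_interpolant mu; rewrite van ?mulr0 //.
  by rewrite (mdeg_rearr pe).
by apply: contraNneq np => ->.
Qed.

Definition Psum lam : {mpoly Kqt[n]} :=
  \sum_(mu : 'X_{1..n < (mdeg lam).+1} | rearr mu lam && true) fstar lam mu.

Lemma Psum_spec lam : is_partition lam -> mspec1 (Psum lam) (E1 (revm lam)).
Proof.
move=> pl.
have [hU hc] := sum_fword E1_dominated E1_unitri E1_descent_ex E1_flat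
  xpredT pl (fun mu => red_word_sigma pl).
rewrite -(inU_eq E1_unitri hU (inU_E E1 (revm_rearr lam))).
  by apply: mspec1_sum => mu _; exact: mspec1_fstar.
move=> nu pe; rewrite hc // E1_increasing_coef //; first exact: revm_increasing.
by apply: rearr_trans pe _; rewrite rearr_sym revm_rearr.
Qed.

Lemma Psum_IsPstar lam : is_partition lam -> IsPstar lam (Psum lam).
Proof.
move=> pl.
have [hU hc] := sum_fword Estar_dominated Estar_unitri Estar_descent (@hki_Estar_flat n)
  xpredT pl (fun mu => red_word_sigma pl).
have eP : Psum lam = \sum_(mu : 'X_{1..n < (mdeg lam).+1} | rearr mu lam && true)
    fword tK (@Estar n) lam (sigma_word lam mu) by apply: eq_bigr => mu _; exact: fstarE.
rewrite -/(sigma_word lam _) -eP in hU hc *.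
have dom := inU_dominated Estar_dominated hU.
split; last by move=> nu pn le_nu ne; apply: (inU_vanish hU le_nu);
  apply: contra ne => /(rearr_partition pn pl)->.
(* With all coefficients on the class equal to 1, [hk_stay_swap] shows that [T_i] multiplies them by
   [t]; hence [T_i] acts on the sum as [t]. *)
- apply: symmetric_sadj => i; apply: hk_fix (lo_hi_neq i) tK_neq0 _.
  apply: (inU_eq Estar_unitri (lam := lam)).
  + exact: (inU_hk Estar_descent (@hki_Estar_flat n)).
  + exact: inUZ.
  move=> nu pe; rewrite (mcoeff_hk_rearr _ (lo_hi_neq i) dom pe) mcoeffZ !hc //; last first.
    exact: rearr_trans (rearr_swm _ _ _) pe.
  by rewrite !mulr1 hk_stay_swap.
- exact: dominated_msize.
- by rewrite hc // rearr_refl.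
Qed.

(** Swapping distinct adjacent parts permutes the coordinates of the node, so a symmetric polynomial
    only sees the sorted composition. *)
Lemma sym_tilde_sorted nu : exists2 lam, is_partition lam & rearr nu lam /\
  forall p, p \is symmetric -> p.@[tilde nu] = p.@[tilde lam].
Proof.
elim/sort_ind: nu => [lam pl|nu i lt_i [lam pl [pe h]]].
  by exists lam => //; split=> //; exact: rearr_refl.
exists lam => //; split; first exact: rearr_trans (rearr_swm _ _ _) pe.
move=> p sp; rewrite -(h p sp).
have ne : nu (lo_ix i) != nu (hi_ix i) by rewrite neq_ltn lt_i orbT.
rewrite (meval_eq p (tilde_sw ne)) -meval_msym.
by move/issymP: sp => ->.
Qed.

Lemma IsPstar_uniq lam p p' : is_partition lam -> IsPstar lam p -> IsPstar lam p' -> p = p'.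
Proof.
move=> pl [y1 s1 c1 v1] [y2 s2 c2 v2].
apply: (@interpolation_uniq _ (mdeg lam) lam _ _ lam) => // nu le_nu.
have [kap pk [pe h]] := sym_tilde_sorted nu; rewrite !h //.
case: (eqVneq kap lam) => [->|ne]; first by right.
by left; split; [apply: v1|apply: v2] => //; rewrite -(mdeg_rearr pe).
Qed.

Lemma Pstar_spec lam : is_partition lam -> mspec1 (Pstar lam) (E1 (revm lam)).
Proof.
move=> pl; have hP := Psum_IsPstar pl.
have hE : IsPstar lam (Pstar lam).
  by apply: (epsilon_spec (inhabits 0) (IsPstar lam)); exists (Psum lam).
by rewrite (IsPstar_uniq pl hE hP); exact: Psum_spec.
Qed.

(** For a single column the recursion stops after one step. *)
Lemma Pstar_ones_spec k : (k <= n)%N -> mspec1 (Pstar (ones n k)) (estar n k).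
Proof.
move=> kn; have po : is_partition (ones n k).
  by apply/partitionP=> i j le_ij; rewrite !mnmE; case: (ltnP j k) => // /(leq_ltn_trans le_ij)->.
have := Pstar_spec po; rewrite (E1_rev_rec po).
have -> : predm (ones n k) = 0%MM.
  by apply/mnmP=> i; rewrite !mnmE; case: ltnP.
have -> : conjp (ones n k) 1 = k.
  by rewrite -[RHS](card_front kn); apply: eq_card => i; rewrite !inE mnmE lt0b.
by rewrite revm0 E1_0 mulr1.
Qed.

End AtOne.

Theorem theorem7p1 (n : nat) :
  (forall lam : 'X_{1..n}, is_partition lam -> (0 < part1 lam)%N ->
   forall S : {set 'I_n}, #|S| = plen lam ->
     mspec1
       (\sum_(mu : 'X_{1..n < (mdeg lam).+1} |
                perm_eq (val (val (val mu))) (val (val lam)) && (supp mu == S))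
           fstar lam mu)
       (Sfactor S * \prod_(2 <= i < (part1 lam).+1) estar n (conjp lam i)))
  /\
  (forall lam : 'X_{1..n}, is_partition lam ->
   exists g : nat -> {mpoly Kt[n]},
     [/\ forall i, (1 <= i <= part1 lam)%N ->
                   mspec1 (Pstar (ones n (conjp lam i))) (g i),
         mspec1 (Pstar lam) (\prod_(1 <= i < (part1 lam).+1) g i) &
         \prod_(1 <= i < (part1 lam).+1) g i
           = \prod_(1 <= i < (part1 lam).+1) estar n (conjp lam i)]).
Proof.
split=> [lam pl _ S cS|lam pl]; first exact: sum_fstar_supp.
exists (fun i => estar n (conjp lam i)); split=> // [i _|].
  exact/Pstar_ones_spec/conjp_le.
by rewrite -(E1_rev_prod pl); exact: Pstar_spec.
Qed.
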